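(* Let $S_1=\{(2,-3,-3),(2,-2,4),(3,-2,0),(3,-2,1),(3,-2,2),(3,-2,3),(4,-4,-4),(4,-3,4)\}$. If $(t_1,t_2,t_3)\in S_1$, then for all integers $n\geq 0$, $$a_{1^{t_1}2^{t_2}3^{t_3}}(2n)>0,\qquad a_{1^{t_1}2^{t_2}3^{t_3}}(2n+1)<0.$$
   Context: For $|q|<1$ (or as formal power series in $q$) let $f_j:=(q^j;q^j)_\infty=\prod_{k\ge 1}(1-q^{jk})$ for each positive integer $j$. For a positive integer $m$ and integers $t_1,\dots,t_m$ (possibly zero or negative), the integers $a_{1^{t_1}2^{t_2}\cdots m^{t_m}}(n)$, $n\ge 0$, are defined by $\sum_{n=0}^\infty a_{1^{t_1}2^{t_2}\cdots m^{t_m}}(n)q^n=f_1^{t_1}f_2^{t_2}\cdots f_m^{t_m}$. Factors with exponent $0$ may be omitted from the notation. *)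

(* Defs.v *)
From mathcomp Require Import all_boot all_order all_algebra.

Set Implicit Arguments.
Unset Strict Implicit.
Unset Printing Implicit Defensive.

Import Order.TTheory GRing.Theory Num.Theory.
Local Open Scope ring_scope.

(* A formal power series over R is its sequence of coefficients. *)
Definition fps (R : Type) := nat -> R.

Definition fps_one (R : comUnitRingType) : fps R := fun n => (n == 0%N)%:R.

Definition fps_mul (R : comUnitRingType) (a b : fps R) : fps R :=
  fun n => \sum_(i < n.+1) a i * b (n - i)%N.

(* The first n coefficients of 1 / a, obtained by solving a * b = 1 for the
   coefficients of b one after the other. *)
Fixpoint fps_inv_seq (R : comUnitRingType) (a : fps R) (n : nat) : seq R :=
  if n is m.+1 then
    let s := fps_inv_seq a m in
    rcons s ((a 0%N)^-1 * (fps_one R m - \sum_(i < m) a (m - i)%N * s`_i))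
  else [::].

(* Meaningful when the constant term of a is a unit; see fps_mulV. *)
Definition fps_inv (R : comUnitRingType) (a : fps R) : fps R :=
  fun n => (fps_inv_seq a n.+1)`_n.

Definition fps_expz (R : comUnitRingType) (a : fps R) (z : int) : fps R :=
  match z with
  | Posz k => iter k (fps_mul a) (fps_one R)
  | Negz k => iter k.+1 (fps_mul (fps_inv a)) (fps_one R)
  end.

(* f_j = prod_(k >= 1) (1 - q^(j k)), for j > 0.  The factors with k > n do not
   contribute to the coefficient of q^n, so that coefficient is read off the
   partial product over 1 <= k <= n; see euler_fps_stable. *)
Definition euler_fps (j : nat) : fps int :=
  fun n => (\prod_(1 <= k < n.+1) (1 - 'X^(j * k)) : {poly int})`_n.

(* f_1^(t_1) f_2^(t_2) ... f_m^(t_m); the entry t_j sits at index j - 1. *)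
Definition eta_quotient (m : nat) (t : m.-tuple int) : fps int :=
  \big[@fps_mul int/fps_one int]_(i < m) fps_expz (euler_fps i.+1) (tnth t i).

Definition S1 : seq (int * int * int) :=
  [:: (2, -3, -3); (2, -2, 4); (3, -2, 0); (3, -2, 1);
      (3, -2, 2); (3, -2, 3); (4, -4, -4); (4, -3, 4)].

Lemma size_fps_inv_seq (R : comUnitRingType) (a : fps R) n :
  size (fps_inv_seq a n) = n.
Proof. by elim: n => //= n IHn; rewrite size_rcons IHn. Qed.

Lemma nth_fps_inv_seq (R : comUnitRingType) (a : fps R) n i :
  (i < n)%N -> (fps_inv_seq a n)`_i = fps_inv a i.
Proof.
elim: n => // n IHn; rewrite ltnS leq_eqVlt => /orP[/eqP -> //|lt_in].
by rewrite /= nth_rcons size_fps_inv_seq lt_in IHn.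
Qed.

Lemma fps_mulV (R : comUnitRingType) (a : fps R) :
  a 0%N \is a GRing.unit -> fps_mul a (fps_inv a) =1 fps_one R.
Proof.
move=> Ua n; rewrite /fps_mul (reindex_inj rev_ord_inj) /= big_ord_recr /=.
rewrite subSS subnn subn0 {2}/fps_inv /= nth_rcons size_fps_inv_seq ltnn eqxx.
rewrite mulVKr // addrC -addrA -[RHS]addr0; congr (_ + _).
apply/eqP; rewrite addrC subr_eq0; apply/eqP/eq_bigr => i _.
rewrite subSS subKn ?nth_fps_inv_seq //; exact: ltnW.
Qed.

Lemma euler_fps_stable (j n N : nat) : (0 < j)%N -> (n <= N)%N ->
  (\prod_(1 <= k < N.+1) (1 - 'X^(j * k)) : {poly int})`_n = euler_fps j n.
Proof.
move=> j_gt0; elim: N => [|N IHN]; first by rewrite leqn0 => /eqP ->.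
rewrite leq_eqVlt => /orP[/eqP -> //|lt_nN]; rewrite big_nat_recr //=.
rewrite mulrBr mulr1 coefB coefMXn (leq_trans lt_nN) ?leq_pmull // subr0.
exact: IHN.
Qed.

Lemma euler_fps0 (j : nat) : euler_fps j 0 = 1.
Proof. by rewrite /euler_fps big_geq // coef1. Qed.

(* Main.v *)
(* Replacing q by -q, the eight quotients must get positive coefficients.  By the
   Jacobi triple product, this substitution turns
   phi(-q) = f_1^2 / f_2 and f(-q, -q^5) = f_1 f_6^2 / (f_2 f_3) into theta series
   with coefficients >= 0, and f_1 / f_2 = (q; q^2) into (-q; q^2); moreover
   C = f_3^3 / f_1 (3-cores) and 1 / f_j are nonnegative.  Seven quotients are
   products of these, possibly dilated by q |-> q^2 or q |-> q^3; for instance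
   f_1^3 f_3 / f_2^2 = phi(-q) phi(-q^3) f(-q, -q^5) / f_6, and
   f_1^2 f_3^4 / f_2^2 = phi(-q) phi(-q^3)^2 (C / f_3)(q^2).
   Strict positivity is a matter of supports, except for
   f_1^3 f_3^3 / f_2^2 = phi(-q) phi(-q^3)^2 f(-q, -q^5), where it says that every
   3 n + 1 is of the form x^2 + y^2 + z^2 + 3 w^2.  Such a representation follows
   by descent from 12 N = (a^2 + b^2) + (c^2 + 3 d^2) with a^2 + b^2 = 5 mod 12; the
   weighted number of these is a positive twisted divisor sum of N.
   The remaining quotient f_1^2 / (f_2 f_3)^3 is (q; q^2) T / f_6^6 with
   T = psi(q^3)^3 / psi(q) = psi(q^2) psi(q^6) - q T(q^2).  The negative terms of
   T(-q) are absorbed because the coefficients d_n of (-q; q^2) satisfy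
   d_n <= d_(n + 2) for n > 0. *)

Require Import Defs.
From HB Require Import structures.
From mathcomp Require Import all_boot all_order all_algebra.
From mathcomp Require Import finfield.
From mathcomp Require Import boolp.
From mathcomp Require Import ring lra zify.

Set Implicit Arguments.
Unset Strict Implicit.
Unset Printing Implicit Defensive.

Import Order.TTheory GRing.Theory Num.Theory.
Local Open Scope ring_scope.

(** Infinite products enter only through finite Gaussian binomial identities whose coefficients
    stabilise: the triple product, and 3-cores as the coefficient of z^(3 n) in a finite product.
    Liouville's elementary method stands in for modular forms. The weight of a splitting 12 N = m +
    m' is a product of two divisor sums, proportional to those of the characters mod 4 and mod 3. A
    nonzero weight already forces m = a^2 + b^2 and m' = c^2 + 3 d^2, because at a prime where the
    character is -1 the local factor vanishes for odd exponents. So it suffices to extract one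
    nonzero weight from a positive total. For the remaining quotient, the recursion for T is
    unrolled two steps at a time, pairing each negative block with the positive block before it.
    Their exponents differ by an even amount, which suits the comparison of d_n with d_(n + 2). As
    d_0 = 1 and d_2 = 0 there is one bad case, at q^3, and the leading block psi(q^2) psi(q^6) pays
    for it. *)

(** * The ring of formal power series *)

Section FpsRing.
Variable R : comUnitRingType.

(** Equality is taken classically, and [funext] identifies series with equal coefficients, so [ring]
    and rewriting apply to series directly. *)
HB.instance Definition _ := gen_eqMixin (fps R).
HB.instance Definition _ := gen_choiceMixin (fps R).

Definition fps_add (a b : fps R) : fps R := fun n => a n + b n.
Definition fps_opp (a : fps R) : fps R := fun n => - a n.
Definition fps_zero : fps R := fun _ => 0.

Fact fps_addA : associative fps_add.
Proof. by move=> a b c; apply/funext => n; rewrite /fps_add addrA. Qed.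
Fact fps_addC : commutative fps_add.
Proof. by move=> a b; apply/funext => n; rewrite /fps_add addrC. Qed.
Fact fps_add0 : left_id fps_zero fps_add.
Proof. by move=> a; apply/funext => n; rewrite /fps_add add0r. Qed.
Fact fps_addN : left_inverse fps_zero fps_opp fps_add.
Proof. by move=> a; apply/funext => n; rewrite /fps_add addNr. Qed.

HB.instance Definition _ :=
  GRing.isZmodule.Build (fps R) fps_addA fps_addC fps_add0 fps_addN.

Definition fps_trunc (n : nat) (a : fps R) : {poly R} := \poly_(i < n.+1) a i.

(** Truncation is how commutativity and associativity are inherited from [{poly R}]. *)
Lemma fps_mul_trunc (N n : nat) (a b : fps R) : (n <= N)%N ->
  fps_mul a b n = (fps_trunc N a * fps_trunc N b)`_n.
Proof.
move=> le_nN; rewrite coefM; apply: eq_bigr => -[i /= lt_in] _.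
by rewrite !coef_poly !ltnS (leq_trans _ le_nN) // (leq_trans (leq_subr _ _)).
Qed.

Fact fps_mulC : commutative (@fps_mul R).
Proof. by move=> a b; apply/funext => n; rewrite !(@fps_mul_trunc n) // mulrC. Qed.

Fact fps_mulA : associative (@fps_mul R).
Proof.
move=> a b c; apply/funext => n.
transitivity (fps_trunc n a * (fps_trunc n b * fps_trunc n c))`_n.
  rewrite coefM; apply: eq_bigr => -[i /= lt_in] _.
  by rewrite coef_poly lt_in (@fps_mul_trunc n) ?leq_subr.
rewrite mulrA coefM; apply: eq_bigr => -[i /= lt_in] _.
by rewrite coef_poly ltnS leq_subr (@fps_mul_trunc n).
Qed.

Fact fps_mul1 : left_id (@fps_one R) (@fps_mul R).
Proof.
move=> a; apply/funext => n; rewrite /fps_mul big_ord_recl /= subn0 /fps_one /=.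
by rewrite mul1r big1 ?addr0 // => i _; rewrite mul0r.
Qed.

Fact fps_mulDl : left_distributive (@fps_mul R) fps_add.
Proof.
move=> a b c; apply/funext => n; rewrite /fps_mul /fps_add -big_split /=.
by apply: eq_bigr => i _; rewrite mulrDl.
Qed.

Fact fps_one_neq0 : @fps_one R != 0.
Proof. by apply/eqP => /(congr1 (fun a : fps R => a 0%N)) /eqP; rewrite /fps_one oner_eq0. Qed.

HB.instance Definition _ := GRing.Zmodule_isComNzRing.Build (fps R)
  fps_mulA fps_mulC fps_mul1 fps_mulDl fps_one_neq0.

End FpsRing.


Lemma fpsD (R : comUnitRingType) (a b : fps R) n : (a + b) n = a n + b n.
Proof. by []. Qed.

Lemma fpsN (R : comUnitRingType) (a : fps R) n : (- a) n = - a n.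
Proof. by []. Qed.

Lemma fps1 (R : comUnitRingType) n : (1 : fps R) n = (n == 0%N)%:R.
Proof. by []. Qed.

Lemma fpsM (R : comUnitRingType) (a b : fps R) n :
  (a * b) n = \sum_(i < n.+1) a i * b (n - i)%N.
Proof. by []. Qed.

Lemma fps_sum (R : comUnitRingType) (I : Type) (r : seq I) (P : pred I)
  (F : I -> fps R) n : (\sum_(i <- r | P i) F i) n = \sum_(i <- r | P i) F i n.
Proof. by apply: (big_morph (fun a : fps R => a n)). Qed.

(** * Polynomials as series; the substitutions q |-> q^j and q |-> -q; monomials *)

Definition of_poly (R : comUnitRingType) (p : {poly R}) : fps R := fun n => p`_n.

Fact of_poly_zmod (R : comUnitRingType) : zmod_morphism (@of_poly R).
Proof. by move=> p q; apply/funext => n; rewrite /of_poly coefB. Qed.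

Fact of_poly_monoid (R : comUnitRingType) : monoid_morphism (@of_poly R).
Proof.
split=> [|p q]; apply/funext => n; first by rewrite /of_poly coef1.
by rewrite /of_poly coefM.
Qed.

HB.instance Definition _ (R : comUnitRingType) :=
  GRing.isZmodMorphism.Build {poly R} (fps R) (@of_poly R) (@of_poly_zmod R).
HB.instance Definition _ (R : comUnitRingType) :=
  GRing.isMonoidMorphism.Build {poly R} (fps R) (@of_poly R) (@of_poly_monoid R).

(* a(q^j), except that j = 0 gives the constant term of a. *)
Definition dilate (R : comUnitRingType) (j : nat) (a : fps R) : fps R :=
  fun n => if (j %| n)%N then a (n %/ j)%N else 0.

Fact dilate_zmod (R : comUnitRingType) j : zmod_morphism (@dilate R j).
Proof.
by move=> a b; apply/funext => n; rewrite /dilate !fpsD !fpsN; case: ifP => // _; rewrite subrr.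
Qed.

Lemma fpsM_poly (R : comUnitRingType) (p r : {poly R}) (a b : fps R) n :
  (forall i, (i <= n)%N -> p`_i = a i) -> (forall i, (i <= n)%N -> r`_i = b i) ->
  (a * b) n = (p * r)`_n.
Proof.
move=> pa rb; rewrite coefM; apply: eq_bigr => -[i /= lt_in] _.
by rewrite pa // rb // leq_subr.
Qed.

Fact dilate_monoid (R : comUnitRingType) j : monoid_morphism (@dilate R j).
Proof.
split=> [|a b]; apply/funext => n.
  rewrite /dilate !fps1; case: (posnP j) => [->|j0].
    by rewrite dvd0n divn0; case: n.
  case: n => [|n]; first by rewrite dvdn0 div0n.
  by case: ifP => // jn; rewrite eqn0Ngt divn_gt0 // dvdn_leq.
case: (posnP j) => [->|j0].
  rewrite fpsM /dilate dvd0n divn0; case: eqP => [->|n0].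
    by rewrite fpsM !big_ord1.
  rewrite big1 // => -[i /= lt_in] _; rewrite !dvd0n; case: eqP => [->|]; last by rewrite mul0r.
  by rewrite subn0; case: eqP => //; rewrite mulr0.
(* For j > 0, dilation is composition with 'X^j on truncations, and composition is
   multiplicative. *)
rewrite (@fpsM_poly _ (fps_trunc n a \Po 'X^j) (fps_trunc n b \Po 'X^j)); first last.
- move=> i le_in; rewrite coef_comp_poly_Xn // /dilate coef_poly ltnS.
  by rewrite (leq_trans (leq_div _ _)).
- move=> i le_in; rewrite coef_comp_poly_Xn // /dilate coef_poly ltnS.
  by rewrite (leq_trans (leq_div _ _)).
rewrite -comp_polyM coef_comp_poly_Xn // /dilate; case: ifP => // _.
by rewrite -fps_mul_trunc ?leq_div.
Qed.

HB.instance Definition _ (R : comUnitRingType) j :=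
  GRing.isZmodMorphism.Build (fps R) (fps R) (@dilate R j) (@dilate_zmod R j).
HB.instance Definition _ (R : comUnitRingType) j :=
  GRing.isMonoidMorphism.Build (fps R) (fps R) (@dilate R j) (@dilate_monoid R j).

(** The substitution q |-> -q; strict positivity of a twisted series is the sign alternation to be
    proved. *)
Definition twist (a : fps int) : fps int := fun n => (-1) ^+ n * a n.

Fact twist_zmod : zmod_morphism twist.
Proof. by move=> a b; apply/funext => n; rewrite /twist !fpsD !fpsN mulrBr. Qed.

Fact twist_monoid : monoid_morphism twist.
Proof.
split=> [|a b]; apply/funext => n.
  by rewrite /twist !fps1; case: n => [|n]; rewrite ?mulr1 ?mulr0.
rewrite /twist !fpsM mulr_sumr; apply: eq_bigr => -[i /= lt_in] _.
by rewrite -{1}(subnKC (lt_in : (i <= n)%N)) exprD; ring.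
Qed.

HB.instance Definition _ :=
  GRing.isZmodMorphism.Build (fps int) (fps int) twist twist_zmod.
HB.instance Definition _ :=
  GRing.isMonoidMorphism.Build (fps int) (fps int) twist twist_monoid.

Lemma twist_dilate_even j a : ~~ odd j -> twist (dilate j a) = dilate j a.
Proof.
move=> evj; apply/funext => n; rewrite /twist /dilate.
case: ifP => [/dvdnP[k ->]|_]; last by rewrite mulr0.
by rewrite -signr_odd oddM (negbTE evj) andbF mul1r.
Qed.

Lemma twist_dilate_odd j a : odd j -> twist (dilate j a) = dilate j (twist a).
Proof.
move=> oddj; apply/funext => n; rewrite /twist /dilate.
case: ifP => [/dvdnP[k ->]|_]; last by rewrite mulr0.
rewrite mulnK; last by case: j oddj.
by rewrite -signr_odd oddM oddj andbT signr_odd.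
Qed.

Lemma dilateA (i j : nat) (a : fps int) : (0 < i)%N -> (0 < j)%N ->
  dilate i (dilate j a) = dilate (i * j) a.
Proof.
move=> i0 j0; apply/funext => n; rewrite /dilate divnMA.
have [/dvdnP[k ->]|ni] := boolP (i %| n)%N.
  by rewrite mulnK // [(k * i)%N]mulnC dvdn_pmul2l.
by case: ifP => // /(dvdn_trans (dvdn_mulr j (dvdnn i))); rewrite (negbTE ni).
Qed.

Definition qX (k : nat) : fps int := fun n => (n == k)%:R.

Lemma qXM k (a : fps int) n : (qX k * a) n = if (k <= n)%N then a (n - k)%N else 0.
Proof.
rewrite fpsM; case: ifP => [le_kn|lt_nk].
  rewrite (bigD1 (Ordinal (le_kn : k < n.+1)%N)) //= /qX eqxx mul1r big1 ?addr0 //.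
  by move=> [i /= lt_in]; rewrite -val_eqE /= => /negbTE ->; rewrite mul0r.
rewrite big1 // => -[i /= lt_in] _; rewrite /qX; case: eqP => [eik|]; rewrite ?mul0r //.
by rewrite -eik -ltnS lt_in in lt_nk.
Qed.

Lemma qXD k l : qX (k + l) = qX k * qX l.
Proof.
apply/funext => n; rewrite qXM /qX; case: leqP => [le_kn|lt_nk].
  by rewrite -{1}(subnKC le_kn) eqn_add2l.
by rewrite (ltn_eqF (leq_trans lt_nk (leq_addr _ _))).
Qed.

Lemma qX0 : qX 0 = 1. Proof. by []. Qed.

Lemma qXMn k n : qX (k * n) = qX k ^+ n.
Proof. by elim: n => [|n IHn]; rewrite ?muln0 // mulnS qXD IHn exprS. Qed.

Lemma of_polyXn k : of_poly 'X^k = qX k.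
Proof. by apply/funext => n; rewrite /of_poly coefXn. Qed.

Lemma qX_inj k (a b : fps int) : qX k * a = qX k * b -> a = b.
Proof.
move=> eab; apply/funext => n; have /(congr1 (fun c : fps int => c (n + k)%N)) := eab.
by rewrite /= !qXM leq_addl addnK.
Qed.

Lemma dilate_qX i k : (0 < i)%N -> dilate i (qX k) = qX (i * k).
Proof.
move=> i0; apply/funext => n; rewrite /dilate /qX.
case: (boolP (i %| n)%N) => [/dvdnP[l ->]|ni].
  by rewrite mulnK // mulnC eqn_pmul2l.
by case: eqP ni => // ->; rewrite dvdn_mulr.
Qed.

Lemma dilate_nmul (R : comUnitRingType) j (a : fps R) n : (0 < j)%N -> dilate j a (j * n) = a n.
Proof. by move=> j0; rewrite /dilate dvdn_mulr // mulKn. Qed.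

(** * Congruence modulo q^(M + 1), and Euler products up to it *)

Definition eqfps (M : nat) (a b : fps int) := forall n, (n <= M)%N -> a n = b n.

Lemma eqfps_refl M a : eqfps M a a. Proof. by []. Qed.
Lemma eqfps_sym M a b : eqfps M a b -> eqfps M b a.
Proof. by move=> ab n le_nM; rewrite ab. Qed.
Lemma eqfps_trans M b a c : eqfps M a b -> eqfps M b c -> eqfps M a c.
Proof. by move=> ab bc n le_nM; rewrite ab // bc. Qed.

Lemma eqfpsM M a b c d : eqfps M a b -> eqfps M c d -> eqfps M (a * c) (b * d).
Proof.
move=> ab cd n le_nM; rewrite !fpsM; apply: eq_bigr => -[i /= lt_in] _.
rewrite ab ?cd //; last exact: leq_trans le_nM.
exact: leq_trans (leq_subr _ _) le_nM.
Qed.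

Lemma eqfps_le M M' a b : (M' <= M)%N -> eqfps M a b -> eqfps M' a b.
Proof. by move=> le_M ab n le_n; apply: ab; apply: leq_trans le_M. Qed.

Definition f (j : nat) : fps int := euler_fps j.
Definition g (j : nat) : fps int := fps_inv (euler_fps j).

Lemma fgK j : f j * g j = 1.
Proof. by apply/funext/(@fps_mulV _ (euler_fps j)); rewrite euler_fps0 unitr1. Qed.

Lemma f_prod j N : (0 < j)%N -> eqfps N (\prod_(1 <= k < N.+1) (1 - qX (j * k))) (f j).
Proof.
move=> j0 n le_nN; rewrite -[RHS](euler_fps_stable j0 le_nN).
have -> : \prod_(1 <= k < N.+1) (1 - qX (j * k)) =
  of_poly (\prod_(1 <= k < N.+1) (1 - 'X^(j * k))).
  by rewrite rmorph_prod; apply: eq_bigr => k _; rewrite rmorphB rmorph1 /= of_polyXn.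
by [].
Qed.

Lemma dilate_f i j : (0 < i)%N -> (0 < j)%N -> dilate i (f j) = f (i * j).
Proof.
move=> i0 j0; apply/funext => n.
have dlE a b M : eqfps M a b -> dilate i a M = dilate i b M.
  by move=> ab; rewrite /dilate; case: ifP => // _; rewrite ab // leq_div.
rewrite -(dlE _ _ _ (f_prod (N := n) j0)) rmorph_prod /=.
rewrite -(f_prod (N := n) _ (leqnn n)) ?muln_gt0 ?i0 //.
congr (_ n); apply: eq_bigr => k _.
by rewrite rmorphB rmorph1 /= dilate_qX // mulnA.
Qed.

Lemma inv_uniq (R : comUnitRingType) (a b c : fps R) : a * b = 1 -> a * c = 1 -> b = c.
Proof. by move=> ab ac; rewrite -[b]mulr1 -ac mulrA [b * a]mulrC ab mul1r. Qed.

Lemma dilate_g i j : (0 < i)%N -> (0 < j)%N -> dilate i (g j) = g (i * j).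
Proof.
move=> i0 j0; apply: (@inv_uniq _ (f (i * j))); last exact: fgK.
by rewrite -dilate_f // -rmorphM fgK rmorph1.
Qed.

Lemma g_prod j N (h : fps int) : (0 < j)%N ->
  \prod_(1 <= k < N.+1) (1 - qX (j * k)) * h = 1 -> eqfps N h (g j).
Proof.
move=> j0 ph; have -> : h = h * f j * g j by rewrite -mulrA fgK mulr1.
rewrite -[X in eqfps _ _ X]mul1r -ph [X in X * g j]mulrC.
by do 2![apply: eqfpsM => //]; apply/eqfps_sym/f_prod.
Qed.

(** * Gaussian binomials and the Jacobi triple product *)

Section QBinomial.
Variable R : comNzRingType.
Implicit Types P x y : R.

(** Gaussian binomials through a Pascal rule, which makes sense over any commutative ring;
    [qbin_qpoch] is the quotient formula with denominators cleared. *)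
Fixpoint qbin P (m k : nat) : R :=
  match m, k with
  | _, 0%N => 1
  | 0%N, _.+1 => 0
  | m'.+1, k'.+1 => qbin P m' k + P ^+ (m' - k') * qbin P m' k'
  end.

Lemma qbin0 P m : qbin P m 0 = 1. Proof. by case: m. Qed.

Lemma qbinS P m k :
  qbin P m.+1 k.+1 = qbin P m k.+1 + P ^+ (m - k) * qbin P m k.
Proof. by []. Qed.

Lemma qbin_small P m k : (m < k)%N -> qbin P m k = 0.
Proof.
elim: m k => [|m IHm] [|k] // lt_mk; rewrite qbinS !IHm ?mulr0 ?addr0 //.
exact: ltnW.
Qed.

(** Cauchy's q-binomial theorem, kept homogeneous so that in [jacobi_finite] x can be a power of q
    that absorbs negative exponents. *)
Lemma qbinomial P x y m :
  \prod_(j < m) (x + y * P ^+ j) =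
  \sum_(k < m.+1) P ^+ 'C(k, 2) * qbin P m k * x ^+ (m - k) * y ^+ k.
Proof.
elim: m => [|m IHm]; first by rewrite big_ord0 big_ord1 /= !expr0 !mulr1.
rewrite big_ord_recr /= IHm [RHS]big_ord_recl /= mulrDr !mulr_suml.
rewrite [X in X + _]big_ord_recl /= -addrA.
congr (_ + _); first by rewrite !qbin0 !subn0 exprS; ring.
transitivity (\sum_(i < m.+1) (P ^+ 'C(i.+1, 2) * qbin P m i.+1 * x ^+ (m - i) * y ^+ i.+1
  + P ^+ 'C(i, 2) * qbin P m i * x ^+ (m - i) * y ^+ i * (y * P ^+ m))).
  rewrite big_split /= [X in _ = X + _]big_ord_recr /= (@qbin_small _ m m.+1) //.
  rewrite !mulr0 !mul0r addr0; congr (_ + _).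
  apply: eq_bigr => -[i /= lt_im] _; rewrite /bump /= add1n.
  by rewrite -[(m - i)%N]subnSK // !exprS; ring.
apply: eq_bigr => -[i /= lt_im] _; rewrite /bump /= add1n add0n subSS.
have -> : P ^+ m = P ^+ (m - i) * P ^+ i by rewrite -exprD subnK.
rewrite binS bin1 !exprD !exprS; ring.
Qed.

Definition qpoch P (m : nat) := \prod_(1 <= k < m.+1) (1 - P ^+ k).

Lemma qpochS P m : qpoch P m.+1 = qpoch P m * (1 - P ^+ m.+1).
Proof. by rewrite /qpoch big_nat_recr. Qed.

Lemma qpoch0 P : qpoch P 0 = 1.
Proof. by rewrite /qpoch big_geq. Qed.

Lemma qbin_qpoch P m k : (k <= m)%N ->
  qbin P m k * (qpoch P k * qpoch P (m - k)) = qpoch P m.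
Proof.
elim: m k => [|m IHm] [|k] // le_km; rewrite ?qbin0 ?qpoch0 ?subn0 ?mul1r //.
rewrite qbinS subSS; move: le_km; rewrite ltnS leq_eqVlt => /orP[/eqP ->|lt_km].
  rewrite (@qbin_small _ m m.+1) // add0r subnn expr0 mul1r qpochS.
  by have := IHm m (leqnn m); rewrite subnn => e; rewrite -[in RHS]e; ring.
have e1 : qbin P m k.+1 * (qpoch P k.+1 * qpoch P (m - k)) =
    qpoch P m * (1 - P ^+ (m - k)).
  by rewrite -(IHm k.+1) // -[(m - k)%N](subnSK lt_km) [qpoch P (m - k.+1).+1]qpochS; ring.
have e2 : P ^+ (m - k) * qbin P m k * (qpoch P k.+1 * qpoch P (m - k)) =
    qpoch P m * (P ^+ (m - k) * (1 - P ^+ k.+1)).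
  by rewrite -(IHm k) ?(ltnW lt_km) // [qpoch P k.+1]qpochS; ring.
have e3 : P ^+ m.+1 = P ^+ (m - k) * P ^+ k.+1.
  by rewrite -exprD; congr (_ ^+ _); lia.
by rewrite mulrDl e1 e2 qpochS e3; ring.
Qed.

End QBinomial.

Arguments qbin : simpl never.

Lemma qpoch_f p m : (0 < p)%N -> eqfps m (qpoch (qX p) m) (f p).
Proof.
move=> p0; apply: eqfps_trans (f_prod p0).
by rewrite /qpoch; under eq_bigr do rewrite -qXMn.
Qed.

(** In the quotient formula the three q-factorials, of m, k and m - k, all agree with f_p up to
    degree M, so a single 1 / f_p survives. *)
Lemma qbin_lim p M m k : (0 < p)%N -> (M + k <= m)%N -> (M <= k)%N ->
  eqfps M (qbin (qX p) m k * f p) 1.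
Proof.
move=> p0 le_m le_k.
have qf n : (M <= n)%N -> eqfps M (qpoch (qX p) n) (f p).
  by move=> le_n; exact: eqfps_le le_n (qpoch_f p0).
have le_km : (k <= m)%N by apply: leq_trans (leq_addl _ _) le_m.
apply: (@eqfps_trans _ (qpoch (qX p) m * g p)); last first.
  rewrite -(fgK p); apply: eqfpsM => //; apply: qf; lia.
rewrite -(qbin_qpoch _ le_km) -!mulrA; apply: eqfpsM => //.
rewrite -[f p]mulr1 -{1}(fgK p).
by apply: eqfpsM; last apply: eqfpsM => //; apply/eqfps_sym/qf; lia.
Qed.

(* Ramanujan's theta function f(e q^a, e q^b), the sum over k in Z of
   e^k q^((a + b) k (k - 1) / 2 + a k), split into k >= 0 and k < 0. *)
Definition theta_exp (a b k : nat) : nat := ((a + b) * 'C(k, 2) + a * k)%N.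

Definition theta (e : int) (a b : nat) : fps int := fun n =>
  \sum_(k < n.+2) e ^+ k * (n == theta_exp a b k)%:R +
  \sum_(k < n.+1) e ^+ k.+1 * (n == theta_exp b a k.+1)%:R.

(** This makes the finite ranges in [theta] exhaustive. The successor is there because a may be 0:
    [theta_exp 0 1 1] is 0. *)
Lemma theta_exp_ge a b k : (0 < a + b)%N -> (k <= (theta_exp a b k).+1)%N.
Proof.
move=> p0; rewrite /theta_exp; have : (k <= 'C(k, 2).+1)%N.
  case: k => // k; rewrite ltnS; elim: k => // k IHk.
  by rewrite binS bin1; lia.
by nia.
Qed.

Definition cst (e : int) : fps int := of_poly e%:P.

Definition theta_prod (e : int) (a b n : nat) : fps int :=
  \prod_(j < n) (1 + cst e * qX (a + (a + b) * j)) *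
  \prod_(j < n) (1 + cst e * qX (b + (a + b) * j)).

Lemma cstM e a n : (cst e * a) n = e * a n.
Proof.
rewrite fpsM big_ord_recl /= big1 ?addr0 => [|i _]; last first.
  by rewrite /cst /of_poly coefC /= mul0r.
by rewrite subn0 /cst /of_poly coefC.
Qed.

Lemma bin2D m n : 'C(m + n, 2) = ('C(m, 2) + m * n + 'C(n, 2))%N.
Proof.
elim: n => [|n IHn]; first by rewrite addn0 muln0 bin0n !addn0.
by rewrite addnS !binS !bin1 IHn; lia.
Qed.

Lemma bin2_sqr n : (n * n = 'C(n, 2) + 'C(n, 2) + n)%N.
Proof. by elim: n => // n IHn; rewrite binS bin1; lia. Qed.

(** The q-binomial theorem with 2 n factors, x = q^((a + b) n) and y = e q^a, its index recentred at
    n. As e is its own inverse, terms of negative index also carry positive powers of e. *)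
Lemma jacobi_finite e a b n : e ^+ 2 = 1 -> theta_prod e a b n =
  \sum_(k < n.+1) cst (e ^+ k) * qX (theta_exp a b k) * qbin (qX (a + b)) (n + n) (n + k) +
  \sum_(k < n) cst (e ^+ k.+1) * qX (theta_exp b a k.+1) *
     qbin (qX (a + b)) (n + n) (n - k.+1).
Proof.
move=> e2; pose p := (a + b)%N.
have ce2 : cst e ^+ 2 = 1 by rewrite /cst -!rmorphXn /= e2 !rmorph1.
have cstX k : cst (e ^+ k) = cst e ^+ k by rewrite /cst -!rmorphXn.
(* The power of q pulled out of the 2 n factors: q^(a + p j) from each of the first n, q^(p n) from
   each of the last n. *)
pose K := (a * n + p * ('C(n, 2) + n * n))%N.
suff: qX K * (cst e ^+ n * theta_prod e a b n) = qX K * (cst e ^+ n * (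
  \sum_(k < n.+1) cst (e ^+ k) * qX (theta_exp a b k) * qbin (qX p) (n + n) (n + k) +
  \sum_(k < n) cst (e ^+ k.+1) * qX (theta_exp b a k.+1) * qbin (qX p) (n + n) (n - k.+1))).
  by move=> /qX_inj /(congr1 ( *%R (cst e ^+ n))); rewrite !mulrA -exprMn -expr2 ce2 expr1n !mul1r.
have := @qbinomial _ (qX p) (qX (p * n)) (cst e * qX a) (n + n).
have -> : \prod_(j < n + n) (qX (p * n) + cst e * qX a * qX p ^+ j) =
   qX K * (cst e ^+ n * theta_prod e a b n).
  rewrite big_split_ord /= /theta_prod.
  transitivity ((\prod_(j < n) (cst e * qX (a + p * j))) * 
     (\prod_(j < n) (1 + cst e * qX (b + p * j))) * 
     ((\prod_(j < n) qX (p * n)) * \prod_(j < n) (1 + cst e * qX (a + p * j)))).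
    congr (_ * _); last first.
      rewrite -big_split /=; apply: eq_bigr => j _.
      by rewrite -qXMn !qXD mulnDr qXD; ring.
    have -> : \prod_(j < n) (1 + cst e * qX (b + p * j)) =
       \prod_(j < n) (1 + cst e * qX (b + p * (n - j.+1))).
      by rewrite (reindex_inj rev_ord_inj).
    rewrite -big_split /=; apply: eq_bigr => -[j /= lt_jn] _.
    rewrite -qXMn mulrDr mulr1 addrC -mulrA -qXD; congr (_ + _).
    transitivity (cst e ^+ 2 * qX ((a + p * j) + (b + p * (n - j.+1)))).
      by rewrite ce2 mul1r /p; congr qX; nia.
    by rewrite qXD; ring.
  rewrite big_split /= !prodr_const !card_ord -!qXMn.
  have -> : \prod_(j < n) qX (a + p * j) = qX (a * n + p * 'C(n, 2)).
    elim: n {K} => [|m IHm]; first by rewrite big_ord0 muln0 bin0n muln0.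
    rewrite big_ord_recr /= IHm -qXD; congr qX; rewrite binS bin1; lia.
  have -> : K = (a * n + p * 'C(n, 2) + p * n * n)%N by rewrite /K; lia.
  by rewrite [qX (_ + _ + _)]qXD -/p; ring.
move=> ->.
have splits (F : nat -> fps int) : \sum_(k < (n + n).+1) F k =
   \sum_(k < n.+1) F (n + k)%N + \sum_(k < n) F (n - k.+1)%N.
  rewrite -addnS big_split_ord /= addrC; congr (_ + _).
  by rewrite (reindex_inj rev_ord_inj).
rewrite (splits (fun k => qX p ^+ 'C(k, 2) * qbin (qX p) (n + n) k *
  qX (p * n) ^+ (n + n - k) * (cst e * qX a) ^+ k)).
rewrite !mulrDr !mulr_sumr; congr (_ + _); apply: eq_bigr => -[k /= lt_kn] _.
  rewrite exprMn -!qXMn cstX exprD.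
  transitivity (cst e ^+ n * cst e ^+ k * qbin (qX p) (n + n) (n + k) *
     qX (p * 'C(n + k, 2) + p * n * (n + n - (n + k)) + a * (n + k))).
    by rewrite !qXD; ring.
  have -> : (p * 'C(n + k, 2) + p * n * (n + n - (n + k)) + a * (n + k) =
     K + theta_exp a b k)%N.
    rewrite bin2D.
    have -> : (n + n - (n + k) = n - k)%N by lia.
    rewrite /K /theta_exp -/p.
    have [l ->] : exists l, n = (k + l)%N by exists (n - k)%N; lia.
    by rewrite addKn; nia.
  by rewrite qXD; ring.
rewrite exprMn -!qXMn cstX.
have ee : cst e ^+ n * cst e ^+ k.+1 = cst e ^+ (n - k.+1).
  rewrite -[in LHS](subnK lt_kn) exprD -mulrA -exprMn -expr2 ce2 expr1n mulr1 //.
transitivity (cst e ^+ (n - k.+1) * qbin (qX p) (n + n) (n - k.+1) *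
   qX (p * 'C(n - k.+1, 2) + p * n * (n + n - (n - k.+1)) + a * (n - k.+1))).
  by rewrite !qXD; ring.
have -> : (p * 'C(n - k.+1, 2) + p * n * (n + n - (n - k.+1)) + a * (n - k.+1) =
     K + theta_exp b a k.+1)%N.
  rewrite /K /theta_exp [(b + a)%N]addnC -/p.
  have [l ->] : exists l, n = (k.+1 + l)%N by exists (n - k.+1)%N; lia.
  have -> : ((k.+1 + l) + (k.+1 + l) - ((k.+1 + l) - k.+1) = k.+1 + k.+1 + l)%N by lia.
  have -> : (k.+1 + l - k.+1 = l)%N by lia.
  by have := bin2_sqr k.+1; rewrite bin2D /p; nia.
by rewrite qXD -ee; ring.
Qed.

Lemma theta_wide e a b n N : (0 < a + b)%N -> (n < N)%N -> theta e a b n =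
  \sum_(k < N.+1) e ^+ k * (n == theta_exp a b k)%:R +
  \sum_(k < N) e ^+ k.+1 * (n == theta_exp b a k.+1)%:R.
Proof.
move=> p0 lt_nN; rewrite /theta; congr (_ + _).
  rewrite -(big_mkord xpredT (fun k => e ^+ k * (n == theta_exp a b k)%:R)).
  rewrite -[RHS](big_mkord xpredT (fun k => e ^+ k * (n == theta_exp a b k)%:R)).
  rewrite [RHS](@big_cat_nat _ _ _ n.+2) //= [X in _ + X]big_nat_cond [X in _ + X]big1 ?addr0 //.
  move=> k /andP[/andP[le_k _] _]; have := theta_exp_ge k p0.
  by case: eqP => [<-|]; rewrite ?mulr0 // => ?; lia.
rewrite -(big_mkord xpredT (fun k => e ^+ k.+1 * (n == theta_exp b a k.+1)%:R)).
rewrite -[RHS](big_mkord xpredT (fun k => e ^+ k.+1 * (n == theta_exp b a k.+1)%:R)).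
rewrite [RHS](@big_cat_nat _ _ _ n.+1) //= [X in _ + X]big_nat_cond [X in _ + X]big1 ?addr0 //.
rewrite addnC in p0.
move=> k /andP[/andP[le_k _] _]; have := theta_exp_ge k.+1 p0.
by case: eqP => [<-|]; rewrite ?mulr0 // => ?; lia.
Qed.

Lemma jacobi_triple e a b n : e ^+ 2 = 1 -> (0 < a + b)%N ->
  (theta_prod e a b (n + n).+1 * f (a + b)) n = theta e a b n.
Proof.
move=> e2 p0; rewrite (theta_wide e (N := (n + n).+1) p0); last lia.
rewrite jacobi_finite // mulrDl !mulr_suml fpsD !fps_sum.
have term c x M k : (x <= n -> n + k <= M)%N -> (x <= n -> n <= k)%N ->
    (cst c * qX x * qbin (qX (a + b)) M k * f (a + b)) n = c * (n == x)%:R.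
  move=> h1 h2; rewrite -!mulrA cstM qXM; congr (_ * _).
  case: leqP => [le_xn|lt_nx]; last by rewrite (ltn_eqF lt_nx).
  rewrite (@qbin_lim _ n) ?leq_subr ?h1 ?h2 // fps1; congr (_%:R); lia.
congr (_ + _); apply: eq_bigr => -[k /= lt_k] _; rewrite term //.
- by have := theta_exp_ge k p0; lia.
- by have := theta_exp_ge k p0; lia.
- by have := theta_exp_ge k.+1 (_ : 0 < b + a)%N; rewrite addnC => /(_ p0); lia.
- by have := theta_exp_ge k.+1 (_ : 0 < b + a)%N; rewrite addnC => /(_ p0); lia.
Qed.

(** * Theta functions as eta quotients *)

Lemma eqfps_div M (a b c u v : fps int) :
  eqfps M (a * b) c -> eqfps M b u -> u * v = 1 -> eqfps M a (c * v).
Proof.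
move=> abc bu uv; rewrite -[a]mulr1 -uv mulrA; apply: eqfpsM => //.
by apply: eqfps_trans abc; apply: eqfpsM => //; apply: eqfps_sym.
Qed.

Lemma prod_residues (F : nat -> fps int) p n :
  \prod_(1 <= k < (p * n).+1) F k = \prod_(i < p) \prod_(j < n) F (i.+1 + p * j)%N.
Proof.
rewrite exchange_big /= big_add1 /=.
elim: n => [|n IHn]; first by rewrite muln0 big_geq // big_ord0.
rewrite big_ord_recr /= -IHn mulnS (@big_cat_nat _ _ _ (p * n)) ?leq_addl //=.
congr (_ * _); rewrite -{1}[(p * n)%N]add0n big_addn addnK big_mkord.
by apply: eq_bigr.
Qed.

(** The partial product (- e q^i; q^p)_n, one residue class i mod p. *)
Definition rprod (e : int) (i p n : nat) := \prod_(j < n) (1 + cst e * qX (i + p * j)).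

Lemma cst1 : cst 1 = 1. Proof. by rewrite /cst rmorph1. Qed.
Lemma cstN1 : cst (-1) = -1. Proof. by rewrite /cst rmorphN1 rmorphN rmorph1. Qed.

Lemma prod_minus_f s p n M : (0 < s)%N -> (M <= p * n)%N ->
  eqfps M (\prod_(i < p) rprod (-1) (s * i.+1) (s * p) n) (f s).
Proof.
move=> s0 le_M; apply: (eqfps_le le_M); apply: eqfps_trans (f_prod s0).
have -> : \prod_(i < p) rprod (-1) (s * i.+1) (s * p) n =
   \prod_(1 <= k < (p * n).+1) (1 - qX (s * k)); last by [].
rewrite (prod_residues (fun k => 1 - qX (s * k))); apply: eq_bigr => i _.
by apply: eq_bigr => j _; rewrite cstN1 mulN1r mulnDr mulnA.
Qed.

(** From (1 + x) (1 - x) = 1 - x^2 for x = q^(s k), after joining the p residue classes. *)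
Lemma prod_plus_f s p n M : (0 < s)%N -> (M <= p * n)%N ->
  eqfps M (\prod_(i < p) rprod 1 (s * i.+1) (s * p) n) (f (2 * s) * g s).
Proof.
move=> s0 le_M; apply: (eqfps_div _ (f_prod s0) (fgK s)).
have s20 : (0 < 2 * s)%N by rewrite muln_gt0.
apply: eqfps_trans (f_prod s20).
have -> : \prod_(i < p) rprod 1 (s * i.+1) (s * p) n =
   \prod_(1 <= k < (p * n).+1) (1 + qX (s * k)).
  rewrite (prod_residues (fun k => 1 + qX (s * k))); apply: eq_bigr => i _.
  by apply: eq_bigr => j _; rewrite cst1 mul1r mulnDr mulnA.
move=> i le_iM.
have e1 : eqfps M (\prod_(1 <= k < (p * n).+1) (1 - qX (s * k))) (f s).
  exact: eqfps_le le_M (f_prod s0).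
have e2 : eqfps M (\prod_(1 <= k < (p * n).+1) (1 - qX (2 * s * k))) (f (2 * s)).
  exact: eqfps_le le_M (f_prod s20).
transitivity ((\prod_(1 <= k < (p * n).+1) (1 + qX (s * k)) *
  \prod_(1 <= k < (p * n).+1) (1 - qX (s * k))) i).
  apply: (@eqfpsM M) le_iM => //; apply: eqfps_trans (f_prod s0) (eqfps_sym e1).
rewrite -big_split /=.
transitivity ((\prod_(1 <= k < (p * n).+1) (1 - qX (2 * s * k))) i).
  congr (_ i); apply: eq_bigr => k _; rewrite -mulnA mul2n -addnn qXD.
  by have /(_ (qX (s * k))) : forall x : fps int, (1 + x) * (1 - x) = 1 - x * x by move=> x; ring.
by rewrite e2 // (f_prod s20 le_iM).
Qed.

Lemma theta_phi : theta (-1) 1 1 = f 1 ^+ 2 * g 2.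
Proof.
apply/funext => n; rewrite -jacobi_triple //; set m := (n + n).+1.
have -> : f 1 ^+ 2 * g 2 = (f 1 * g 2) * (f 1 * g 2) * f 2.
  by rewrite -[LHS]mulr1 -(fgK 2); ring.
suff O : eqfps n (rprod (-1) 1 2 m) (f 1 * g 2).
  by apply: (@eqfpsM n) => //; apply: eqfpsM.
have E : eqfps n (rprod (-1) 2 2 m) (f 2).
  have := @prod_minus_f 2 1 m n; rewrite big_ord1; apply => //; rewrite /m; lia.
apply: (eqfps_div _ E (fgK 2)).
have := @prod_minus_f 1 2 m n isT; rewrite big_ord_recr big_ord1 /=; apply; rewrite /m; lia.
Qed.

(** The classes 1 and 5 mod 6 are all classes without the multiples of 2 and of 3; the class 0 is
    then removed twice and has to be restored. *)
Lemma theta_15 : theta (-1) 1 5 = f 1 * f 6 ^+ 2 * g 2 * g 3.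
Proof.
apply/funext => n; rewrite -jacobi_triple //; set m := (n + n).+1.
have -> : f 1 * f 6 ^+ 2 * g 2 * g 3 = (f 1 * f 6 * g 2 * g 3) * f 6 by ring.
apply: (@eqfpsM n) => //.
have R6 : eqfps n (rprod (-1) 6 6 m) (f 6).
  have := @prod_minus_f 6 1 m n; rewrite big_ord1; apply => //; rewrite /m; lia.
have R3 : eqfps n (rprod (-1) 3 6 m * rprod (-1) 6 6 m) (f 3).
  have := @prod_minus_f 3 2 m n; rewrite big_ord_recr big_ord1; apply => //; rewrite /m; lia.
have R2 : eqfps n (rprod (-1) 2 6 m * rprod (-1) 4 6 m * rprod (-1) 6 6 m) (f 2).
  have := @prod_minus_f 2 3 m n; rewrite !big_ord_recr big_ord0 /= mul1r; apply => //; rewrite /m; lia.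
have R1 := @prod_minus_f 1 6 m n isT.
rewrite !big_ord_recr big_ord0 /= mul1r /= in R1.
apply: (eqfps_div _ R3 (fgK 3)); apply: (eqfps_div _ R2 (fgK 2)).
rewrite /theta_prod /= -!/(rprod _ _ _ _).
have -> : rprod (-1) 1 6 m * rprod (-1) 5 6 m *
   (rprod (-1) 3 6 m * rprod (-1) 6 6 m) *
   (rprod (-1) 2 6 m * rprod (-1) 4 6 m * rprod (-1) 6 6 m) =
   rprod (-1) 1 6 m * rprod (-1) 2 6 m * rprod (-1) 3 6 m * rprod (-1) 4 6 m *
   rprod (-1) 5 6 m * rprod (-1) 6 6 m * rprod (-1) 6 6 m by ring.
apply: eqfpsM => //; apply: R1; rewrite /m; lia.
Qed.

Lemma theta_psi : theta 1 0 1 = 2 * (f 2 ^+ 2 * g 1).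
Proof.
apply/funext => n; rewrite -jacobi_triple //; set m := (n + n).+1.
have -> : 2 * (f 2 ^+ 2 * g 1) = (2 * (f 2 * g 1)) * (f 2 * g 1) * f 1.
  by rewrite -[LHS]mulr1 -(fgK 1); ring.
apply: (@eqfpsM n) => //; apply: eqfpsM; last first.
  have := @prod_plus_f 1 1 m n; rewrite big_ord1; apply => //; rewrite /m; lia.
(* With a = 0 the factor j = 0 is 1 + q^0 = 2: each triangular number is hit twice. *)
rewrite /m big_ord_recl; apply: eqfpsM; first by rewrite cst1 mul1r.
have := @prod_plus_f 1 1 (n + n)%N n; rewrite big_ord1; apply => //; lia.
Qed.

Lemma theta_12 : theta 1 1 2 = f 2 * f 3 ^+ 2 * g 1 * g 6.
Proof.
apply/funext => n; rewrite -jacobi_triple //; set m := (n + n).+1.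
have -> : f 2 * f 3 ^+ 2 * g 1 * g 6 = f 2 * g 1 * (f 3 * g 6) * f 3 by ring.
apply: (@eqfpsM n) => //.
have R3 : eqfps n (rprod 1 3 3 m) (f 6 * g 3).
  have := @prod_plus_f 3 1 m n; rewrite big_ord1; apply => //; rewrite /m; lia.
apply: (eqfps_div _ R3); last first.
  by transitivity ((f 6 * g 6) * (f 3 * g 3)); [ring | rewrite !fgK mulr1].
have := @prod_plus_f 1 3 m n isT; rewrite !big_ord_recr big_ord0 /= mul1r /=; apply; rewrite /m; lia.
Qed.

(** * Counting lattice points *)

Lemma count_le_inj (T1 T2 : eqType) (s1 : seq T1) (s2 : seq T2) (P : pred T1)
    (Q : pred T2) (h : T1 -> T2) (h' : T2 -> T1) : uniq s1 ->
  (forall x, x \in s1 -> P x -> [/\ h x \in s2, Q (h x) & h' (h x) = x]) ->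
  (count P s1 <= count Q s2)%N.
Proof.
move=> u1 hP; rewrite -!size_filter -(size_map h); apply: uniq_leq_size.
  rewrite map_inj_in_uniq ?filter_uniq // => x y; rewrite !mem_filter.
  move=> /andP[Px x1] /andP[Py y1] e.
  by have [_ _ <-] := hP x x1 Px; have [_ _ <-] := hP y y1 Py; rewrite e.
move=> _ /mapP[x + ->]; rewrite !mem_filter => /andP[Px x1].
by have [-> ->] := hP x x1 Px.
Qed.

Lemma count_bij (T1 T2 : eqType) (s1 : seq T1) (s2 : seq T2) (P : pred T1) (Q : pred T2)
    (h : T1 -> T2) (h' : T2 -> T1) : uniq s1 -> uniq s2 ->
  (forall x, x \in s1 -> P x -> [/\ h x \in s2, Q (h x) & h' (h x) = x]) ->
  (forall y, y \in s2 -> Q y -> [/\ h' y \in s1, P (h' y) & h (h' y) = y]) ->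
  count P s1 = count Q s2.
Proof.
move=> u1 u2 h1 h2; apply/eqP; rewrite eqn_leq.
by rewrite (count_le_inj u1 h1) (count_le_inj u2 h2).
Qed.

Definition zr (N : nat) : seq int :=
  [seq Posz k | k <- iota 0 N.+1] ++ [seq Negz k | k <- iota 0 N].

Lemma mem_zr N (x : int) : (x \in zr N) = (absz x <= N)%N.
Proof.
rewrite mem_cat; case: x => k.
  rewrite mem_map; last by move=> ? ? [].
  rewrite mem_iota /= add0n ltnS; case: (leqP k N) => //= _.
  by apply/negP => /mapP[].
rewrite [X in X || _](_ : _ = false) /=; last by apply/negP => /mapP[].
rewrite mem_map; last by move=> ? ? [].
by rewrite mem_iota.
Qed.

Lemma zr_uniq N : uniq (zr N).
Proof.
rewrite cat_uniq !map_inj_uniq ?iota_uniq; try by move=> ? ? [].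
by rewrite andbT; apply/hasPn => _ /mapP[k _ ->]; apply/negP => /mapP[].
Qed.

Lemma big_zr (R : nmodType) N (F : int -> R) :
  \sum_(x <- zr N) F x = \sum_(k < N.+1) F (Posz k) + \sum_(k < N) F (Negz k).
Proof.
rewrite big_cat !big_map -(big_mkord xpredT (fun k => F (Posz k))).
by rewrite -(big_mkord xpredT (fun k => F (Negz k))) /index_iota !subn0.
Qed.

Lemma big_zr_shift (R : nmodType) N (F : nat -> R) :
  \sum_(k < (N + N).+1) F k = \sum_(x <- zr N) F (absz (N%:Z + x)).
Proof.
rewrite big_zr -addnS big_split_ord /= addrC; congr (_ + _).
rewrite (reindex_inj rev_ord_inj); apply: eq_bigr => -[k /= lt_kN] _.
by congr F; lia.
Qed.

Definition zbox (N : nat) : seq (int * int) := [seq (x, y) | x <- zr N, y <- zr N].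

Lemma mem_zbox N (z : int * int) : (z \in zbox N) = (absz z.1 <= N)%N && (absz z.2 <= N)%N.
Proof.
case: z => x y; apply/allpairsP/andP => /= [[[a b] /= [+ + [-> ->]]]|[xN yN]].
  by rewrite !mem_zr.
by exists (x, y); rewrite /= !mem_zr.
Qed.

Lemma zbox_uniq N : uniq (zbox N).
Proof. by apply: allpairs_uniq; rewrite ?zr_uniq // => -[? ?] [? ?]. Qed.

Lemma sum_zbox (N : nat) (P : pred (int * int)) :
  (count P (zbox N))%:Z = \sum_(x <- zr N) \sum_(y <- zr N) (P (x, y))%:R.
Proof.
rewrite -sum1_count -natz natr_sum big_mkcond big_allpairs /=.
by apply: eq_bigr => x _; apply: eq_bigr => y _; case: (P _).
Qed.

(** * The generating function of 3-cores *)

Lemma qbin_rmorph (R S : comNzRingType) (h : {rmorphism R -> S}) P m k :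
  qbin (h P) m k = h (qbin P m k).
Proof.
elim: m k => [|m IHm] [|k]; rewrite ?qbin0 ?rmorph1 //.
  by rewrite !qbin_small // rmorph0.
by rewrite !qbinS !IHm rmorphD rmorphM rmorphXn.
Qed.

Lemma coef_qbinomial (R : comNzRingType) (P c : R) m k :
  (\prod_(j < m) (1 + 'X * (c * P ^+ j)%:P))`_k = P ^+ 'C(k, 2) * c ^+ k * qbin P m k.
Proof.
transitivity (\sum_(i < m.+1) P ^+ 'C(i, 2) * c ^+ i * qbin P m i *: 'X^i)`_k.
  have := @qbinomial _ P%:P 1 ('X * c%:P) m.
  under eq_bigr do rewrite -mulrA -polyC_exp -polyCM.
  move=> ->; congr (polyseq _)`_k; apply: eq_bigr => i _.
  by rewrite -mul_polyC expr1n (qbin_rmorph polyC) exprMn !polyCM !polyC_exp; ring.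
rewrite coef_sum; under eq_bigr do rewrite coefZ coefXn.
case: (ltnP k m.+1) => [lt_km|lt_mk].
  rewrite (bigD1 (Ordinal lt_km)) //= eqxx mulr1 big1 ?addr0 // => i.
  by rewrite -val_eqE /= eq_sym => /negbTE ->; rewrite mulr0.
rewrite big1 ?qbin_small ?mulr0 // => -[i /= lt_im] _.
by rewrite gtn_eqF ?mulr0 // (leq_trans lt_im).
Qed.

Lemma sum_ord_trunc (V : nmodType) (F : nat -> V) m M : (m <= M)%N ->
  (forall k, (m <= k)%N -> F k = 0) -> \sum_(k < M) F k = \sum_(k < m) F k.
Proof.
move=> le_mM F0; rewrite -!(big_mkord xpredT F) (@big_cat_nat _ _ _ m) //=.
by rewrite [X in _ + X]big_nat_cond [X in _ + X]big1 ?addr0 // => k /andP[/andP[/F0]].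
Qed.

(** The size of the 3-core attached to the vector (-x-y, x, y) of sum 0. With X = 3 x and Y = 3 y +
    1 it is E such that X^2 + X Y + Y^2 = 3 E + 1. *)
Definition core_exp (z : int * int) : nat :=
  absz (3 * (z.1 * z.1 + z.1 * z.2 + z.2 * z.2) + z.1 + 2 * z.2).

Lemma core_expE x y :
  (core_exp (x, y))%:Z = 3 * (x * x + x * y + y * y) + x + 2 * y.
Proof.
rewrite /core_exp /= gez0_abs //.
have s0 (t : int) : 0 <= t * t by rewrite -expr2 sqr_ge0.
(* 12 E + 4 = (6 x + 3 y + 1)^2 + 3 (3 y + 1)^2, hence E > -1. *)
by have := s0 (6 * x + 3 * y + 1); have := s0 (3 * y + 1); lia.
Qed.

(** 4 (X^2 + X Y + Y^2) is a square plus 3 T^2 for each T among X, Y and X + Y. *)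
Lemma core_exp_bound x y M : (core_exp (x, y) <= M)%N ->
  [/\ absz x <= M.+1, absz y <= M.+1 & absz (x + y)%R <= M.+1]%N.
Proof.
rewrite -lez_nat core_expE => le_M.
have b (t : int) : 3 * ((3 * t) * (3 * t)) <= 4 * (3 * M%:Z + 1) -> (absz t <= M.+1)%N by nia.
have b' (t : int) : 3 * ((3 * t + 1) * (3 * t + 1)) <= 4 * (3 * M%:Z + 1) -> (absz t <= M.+1)%N by nia.
have s0 (t : int) : 0 <= t * t by rewrite -expr2 sqr_ge0.
split; [apply: b | apply: b' | apply: b'].
- by have := s0 (3 * x + 2 * (3 * y + 1)); lia.
- by have := s0 (6 * x + 3 * y + 1); lia.
- by have := s0 (3 * x - (3 * y + 1)); lia.
Qed.

Definition core3 : fps int := f 3 ^+ 3 * g 1.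

(* Coefficient of z^(3n) in prod_(j < 6n) (1 + z q^j), the factors being also
   grouped according to j mod 3. *)
Lemma core_finite n : qbin (qX 1) (6 * n) (3 * n) =
  \sum_(x <- zr n) \sum_(y <- zr n) if (absz (n%:Z + x)%R + absz (n%:Z + y)%R <= 3 * n)%N then
    qX (core_exp (x, y)) * (qbin (qX 3) (2 * n) (absz (n%:Z + x)%R) *
      qbin (qX 3) (2 * n) (absz (n%:Z + y)%R) *
      qbin (qX 3) (2 * n) (3 * n - (absz (n%:Z + x)%R + absz (n%:Z + y)%R))) else 0.
Proof.
(* The power of q that the q-binomial theorem attaches to z^(3 n). *)
pose K := 'C(3 * n, 2).
pose c i k := qX 3 ^+ 'C(k, 2) * qX i ^+ k * qbin (qX 3) (2 * n) k.
have c0 i k : (2 * n < k)%N -> c i k = 0 by move=> lt_nk; rewrite /c qbin_small ?mulr0.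
pose F k1 k2 := if (k1 + k2 <= 3 * n)%N then c 1%N k1 * c 2%N k2 * c 0%N (3 * n - (k1 + k2))%N else 0.
apply: (@qX_inj K).
have -> : qX K * qbin (qX 1) (6 * n) (3 * n) = \sum_(k1 < (n + n).+1) \sum_(k2 < (n + n).+1) F k1 k2.
  transitivity (\prod_(j < 6 * n) (1 + 'X * (1 * qX 1 ^+ j)%:P) : {poly fps int})`_(3 * n).
    by rewrite coef_qbinomial expr1n mulr1 -qXMn mul1n.
  have -> : \prod_(j < 6 * n) (1 + 'X * (1 * qX 1 ^+ j)%:P) =
     \prod_(i < 3) \prod_(j < 2 * n) (1 + 'X * (qX i * qX 3 ^+ j)%:P).
    rewrite exchange_big /=.
    have -> : (6 * n = 3 * (2 * n))%N by lia.
    elim: (2 * n)%N => [|m IHm]; first by rewrite muln0 !big_ord0.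
    rewrite mulnS addnC big_split_ord /= IHm [RHS]big_ord_recr /=; congr (_ * _).
    by apply: eq_bigr => i _; rewrite mul1r -!qXMn -qXD mul1n addnC.
  rewrite ![in LHS]big_ord_recl [in LHS]big_ord0 mulr1 mulrC -mulrA.
  rewrite coefM -[RHS](@sum_ord_trunc _ (fun k1 => \sum_(k2 < (n + n).+1) F k1 k2) _ (3 * n).+1); first last.
  - move=> k1 le_k1; rewrite big1 // => k2 _.
    by rewrite /F c0 ?mul0r ?if_same //; lia.
  - lia.
  apply: eq_bigr => -[k1 /= lt_k1] _; rewrite coef_qbinomial coefM mulr_sumr.
  pose G k2 := F k1 k2.
  rewrite (eq_bigr (fun k2 : 'I__ => G k2)) => [|k2 _]; last first.
    rewrite !coef_qbinomial /G /F /c; case: ifP; last by case: k2 => /=; lia.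
    move=> _; rewrite subnDA; ring.
  (* A bound above both ranges of k2: the sum is padded with zeros up to it, then cut at 2 n + 1. *)
  rewrite -(@sum_ord_trunc _ G _ (5 * n + 2)); first last.
  - by move=> k2 le_k2; rewrite /G /F ifF //; lia.
  - lia.
  rewrite (@sum_ord_trunc _ G (n + n).+1) //; first lia.
  by move=> k2 le_k2; rewrite /G /F [c 2%N _]c0 ?mulr0 ?mul0r ?if_same //; lia.
rewrite (big_zr_shift n (fun k1 => \sum_(k2 < (n + n).+1) F k1 k2)) mulr_sumr.
rewrite big_seq [RHS]big_seq; apply: eq_bigr => x; rewrite mem_zr => xn.
rewrite (big_zr_shift n (fun k2 => F _ k2)) mulr_sumr.
rewrite big_seq [RHS]big_seq; apply: eq_bigr => y; rewrite mem_zr => yn.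
rewrite /F; case: ifP => [le_n|]; rewrite ?mulr0 //.
set k1 := absz (n%:Z + x)%R; set k2 := absz (n%:Z + y)%R.
rewrite /c -!qXMn [RHS]mulrA -[qX K * _]qXD.
have -> : (K + core_exp (x, y) =
  3 * 'C(k1, 2) + 1 * k1 + (3 * 'C(k2, 2) + 2 * k2) + (3 * 'C(3 * n - (k1 + k2), 2) + 0 * (3 * n - (k1 + k2))))%N.
  apply/eqP; rewrite -eqz_nat !PoszD core_expE /K.
  have bz (m : nat) : 2 * ('C(m, 2))%:Z = m%:Z * m%:Z - m%:Z by have := bin2_sqr m; lia.
  have := bz (3 * n)%N; have := bz k1; have := bz k2; have := bz (3 * n - (k1 + k2))%N.
  have -> : (3 * n - (k1 + k2))%N%:Z = n%:Z - x - y by rewrite /k1 /k2; lia.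
  have -> : k1%:Z = n%:Z + x by rewrite /k1; lia.
  have -> : k2%:Z = n%:Z + y by rewrite /k2; lia.
  by lia.
by rewrite !qXD; ring.
Qed.

(** After multiplication of [core_finite] by f_3^3 the left Gaussian binomial tends to 1 / f_1 and
    each of the three on the right is absorbed by one f_3. The bound on N keeps every index in the
    stable range. *)
Lemma core3_count M N : (2 * M + 2 <= N)%N ->
  core3 M = (count (fun z => core_exp z == M) (zbox N))%:Z.
Proof.
move=> le_N; rewrite sum_zbox.
transitivity ((qbin (qX 1) (6 * N) (3 * N) * f 3 ^+ 3) M).
  rewrite /core3 mulrC; apply: (@eqfpsM M) => //; apply: eqfps_sym.
  rewrite -[g 1]mul1r; apply: eqfps_div (fgK 1); last exact: eqfps_refl.
  by apply: qbin_lim; lia.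
rewrite core_finite mulr_suml fps_sum; apply: eq_bigr => x _.
rewrite mulr_suml fps_sum; apply: eq_bigr => y _.
case: (leqP (core_exp (x, y)) M) => [le_M|lt_M]; last first.
  rewrite (gtn_eqF lt_M); case: ifP => _; last by rewrite mul0r.
  by rewrite -[_ * f 3 ^+ 3]mulrA qXM leqNgt lt_M.
have [bx by_ bxy] := core_exp_bound le_M.
rewrite ifT; last lia.
set b1 := qbin _ _ _; set b2 := qbin _ _ _; set b3 := qbin _ _ _.
have -> : qX (core_exp (x, y)) * (b1 * b2 * b3) * f 3 ^+ 3 =
   qX (core_exp (x, y)) * ((b1 * f 3) * (b2 * f 3) * (b3 * f 3)) by ring.
rewrite (@eqfpsM M _ (qX (core_exp (x, y))) _ 1) // ?mulr1; first by rewrite /qX eq_sym.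
rewrite -[X in eqfps _ _ X]mulr1 -[X in eqfps _ _ (X * _)]mulr1.
by do ![apply: eqfpsM]; apply: qbin_lim; lia.
Qed.

(** * Even and odd parts of the 3-core series *)

Definition zexp (a b : nat) (x : int) : nat :=
  match x with Posz k => theta_exp a b k | Negz k => theta_exp b a k.+1 end.

Lemma zexpE (a b : nat) x :
  2 * (zexp a b x)%:Z = (a%:Z + b%:Z) * (x * (x - 1)) + 2 * (a%:Z * x).
Proof.
by case: x => k; rewrite /zexp /theta_exp;
  [have := bin2_sqr k | have := bin2_sqr k.+1; rewrite NegzE]; nia.
Qed.

Lemma zexp_ge a b x : (0 < a + b)%N -> (absz x <= (zexp a b x).+1)%N.
Proof. by case: x => k ab; apply: theta_exp_ge; rewrite // addnC. Qed.

Lemma theta_zr a b n N : (0 < a + b)%N -> (n < N)%N ->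
  theta 1 a b n = \sum_(x <- zr N) (n == zexp a b x)%:R.
Proof.
move=> ab lt_nN; rewrite (theta_wide _ ab lt_nN) big_zr.
by congr (_ + _); apply: eq_bigr => k _; rewrite expr1n mul1r.
Qed.

Lemma theta2_count a b c d n N : (0 < a + b)%N -> (0 < c + d)%N -> (n < N)%N ->
  (theta 1 a b * theta 1 c d) n =
  (count (fun z => zexp a b z.1 + zexp c d z.2 == n)%N (zbox N))%:Z.
Proof.
move=> ab cd lt_nN; rewrite sum_zbox fpsM.
transitivity (\sum_(i < n.+1) \sum_(x <- zr N) \sum_(y <- zr N)
    ((i : nat) == zexp a b x)%:R * (n - i == zexp c d y)%N%:R : int).
  apply: eq_bigr => -[i /= lt_in] _.
  rewrite (theta_zr (N := N)) ?(leq_ltn_trans (lt_in : i <= n)%N) // mulr_suml.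
  apply: eq_bigr => x _; rewrite (theta_zr (N := N)) ?(leq_ltn_trans (leq_subr _ _)) //.
  by rewrite mulr_sumr.
rewrite exchange_big; apply: eq_bigr => x _; rewrite exchange_big; apply: eq_bigr => y _ /=.
case: (leqP (zexp a b x) n) => [le_n|lt_n].
  rewrite (bigD1 (Ordinal (le_n : zexp a b x < n.+1)%N)) //= eqxx mul1r big1 ?addr0.
    by congr (GRing.natmul 1 (nat_of_bool _)); apply/eqP/eqP; lia.
  by move=> i; rewrite -val_eqE /= => /negbTE ->; rewrite mul0r.
rewrite big1 => [|[i /= lt_in] _]; last first.
  by rewrite ltn_eqF ?mul0r // (leq_ltn_trans _ lt_n).
by case: eqP => // e; move: lt_n; rewrite -e; lia.
Qed.

Lemma core_expP x y n : reflect (3 * (x * x + x * y + y * y) + x + 2 * y = n%:Z)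
  (core_exp (x, y) == n).
Proof. by rewrite -eqz_nat core_expE; apply: eqP. Qed.

Lemma zexp_sumP x y n :
  reflect (x * x - x + 3 * (y * y) - y = 2 * n%:Z) (zexp 0 1 x + zexp 1 2 y == n)%N.
Proof.
apply: (iffP eqP) => [<-|e].
  by rewrite PoszD mulrDr !zexpE; ring.
apply/eqP; rewrite -eqz_nat; apply/eqP.
have : 2 * (zexp 0 1 x + zexp 1 2 y)%N%:Z = 2 * n%:Z by rewrite -e PoszD mulrDr !zexpE; ring.
by lia.
Qed.

(** Both solution sets lie inside the box, so inverse maps between them suffice; membership is
    settled here once for three bijections. *)
Lemma core_class n N (p q : pred (int * int)) (h h' : int * int -> int * int) :
  (2 * n + 2 <= N)%N ->
  (forall z, core_exp z = (2 * n)%N -> p z ->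
     [/\ zexp 0 1 (h z).1 + zexp 1 2 (h z).2 = n, q (h z) & h' (h z) = z])%N ->
  (forall z, zexp 0 1 z.1 + zexp 1 2 z.2 = n -> q z ->
     [/\ core_exp (h' z) = 2 * n, p (h' z) & h (h' z) = z])%N ->
  count (fun z => (core_exp z == 2 * n)%N && p z) (zbox N) =
  count (fun z => (zexp 0 1 z.1 + zexp 1 2 z.2 == n)%N && q z) (zbox N).
Proof.
move=> le_N hP h'P; apply: (count_bij (h := h) (h' := h')); rewrite ?zbox_uniq //.
  move=> z _ /andP[/eqP ez pz]; have [e1 e2 e3] := hP z ez pz; split => //; last by rewrite e1 eqxx.
  rewrite mem_zbox; have := zexp_ge (h z).1 (isT : 0 < 0 + 1)%N.
  by have := zexp_ge (h z).2 (isT : 0 < 1 + 2)%N; lia.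
move=> z _ /andP[/eqP ez pz]; have [e1 e2 e3] := h'P z ez pz; split => //; last by rewrite e1 eqxx.
case: (h' z) e1 => x y e1; rewrite mem_zbox.
by have [] := @core_exp_bound x y (2 * n); rewrite ?e1 //=; lia.
Qed.

(* 3 n + 1 = X^2 + X Y + Y^2 with X = 3 x, Y = 3 y + 1. When n is even, exactly
   two of X, Y, X + Y are odd, and an odd one, v, makes
   4 (3 n + 1) = u^2 + 3 v^2 with u odd. *)
Lemma core3_even n : 2 * core3 (2 * n)%N = (theta 1 0 1 * theta 1 1 2) n.
Proof.
pose N := (4 * n + 2)%N.
rewrite (@core3_count _ N); last by rewrite /N; lia.
rewrite (@theta2_count _ _ _ _ _ N) //; last by rewrite /N; lia.
pose P (z : int * int) := core_exp z == (2 * n)%N.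
pose Q (z : int * int) := (zexp 0 1 z.1 + zexp 1 2 z.2 == n)%N.
(* On the theta side v = 2 z.1 - 1 and u = 6 z.2 - 1. The cases v = X, Y and -(X + Y) are told apart
   by z.1 mod 3. *)
have c1 : count (fun z => P z && ((z.1 %% 2)%Z == 1)) (zbox N) =
          count (fun z => Q z && ((z.1 %% 3)%Z == 2)) (zbox N).
  apply: (@core_class _ _ _ _ (fun z => (3 * (z.1 %/ 2)%Z + 2, z.2 + (z.1 %/ 2)%Z + 1))
    (fun z => (2 * (z.1 %/ 3)%Z + 1, z.2 - (z.1 %/ 3)%Z - 1))); first by rewrite /N; lia.
    move=> [x y] /eqP/core_expP /= e px; have [s es] : exists s, x = 2 * s + 1.
      by exists (x %/ 2)%Z; lia.
    have -> : (x %/ 2)%Z = s by lia.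
    split; [apply/eqP/zexp_sumP; subst x; lia | lia | congr (_, _); lia].
  move=> [x y] /eqP/zexp_sumP /= e px; have [s es] : exists s, x = 3 * s + 2.
    by exists (x %/ 3)%Z; lia.
  have -> : (x %/ 3)%Z = s by lia.
  split; [apply/eqP/core_expP; subst x; lia | lia | congr (_, _); lia].
have c2 : count (fun z => P z && ((z.2 %% 2)%Z == 0)) (zbox N) =
          count (fun z => Q z && ((z.1 %% 3)%Z == 1)) (zbox N).
  apply: (@core_class _ _ _ _ (fun z => (3 * (z.2 %/ 2)%Z + 1, - z.1 - (z.2 %/ 2)%Z))
    (fun z => (- z.2 - (z.1 %/ 3)%Z, 2 * (z.1 %/ 3)%Z))); first by rewrite /N; lia.
    move=> [x y] /eqP/core_expP /= e px; have [s es] : exists s, y = 2 * s.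
      by exists (y %/ 2)%Z; lia.
    have -> : (y %/ 2)%Z = s by lia.
    split; [apply/eqP/zexp_sumP; subst y; lia | lia | congr (_, _); lia].
  move=> [x y] /eqP/zexp_sumP /= e px; have [s es] : exists s, x = 3 * s + 1.
    by exists (x %/ 3)%Z; lia.
  have -> : (x %/ 3)%Z = s by lia.
  split; [apply/eqP/core_expP; subst x; lia | lia | congr (_, _); lia].
have c3 : count (fun z => P z && (((z.1 + z.2) %% 2)%Z == 0)) (zbox N) =
          count (fun z => Q z && ((z.1 %% 3)%Z == 0)) (zbox N).
  apply: (@core_class _ _ _ _ (fun z => (- 3 * ((z.1 + z.2) %/ 2)%Z, z.1 - ((z.1 + z.2) %/ 2)%Z))
    (fun z => (z.2 - (z.1 %/ 3)%Z, - (z.1 %/ 3)%Z - z.2))); first by rewrite /N; lia.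
    move=> [x y] /eqP/core_expP /= e px; have [s es] : exists s, y = 2 * s - x.
      by exists ((x + y) %/ 2)%Z; lia.
    have -> : ((x + y) %/ 2)%Z = s by lia.
    split; [apply/eqP/zexp_sumP; subst y; lia | lia | congr (_, _); lia].
  move=> [x y] /eqP/zexp_sumP /= e px; have [s es] : exists s, x = - 3 * s.
    by exists (- (x %/ 3)%Z); lia.
  have -> : (x %/ 3)%Z = - s by lia.
  split; [apply/eqP/core_expP; subst x; lia | lia | congr (_, _); lia].
have cQ : (count (fun z => Q z && ((z.1 %% 3)%Z == 2)) (zbox N) +
  count (fun z => Q z && ((z.1 %% 3)%Z == 1)) (zbox N) +
  count (fun z => Q z && ((z.1 %% 3)%Z == 0)) (zbox N) = count Q (zbox N))%N.
  elim: (zbox N) => //= z s <-; case: (Q z) => /=; last by lia.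
  have : (z.1 %% 3)%Z = 0 \/ (z.1 %% 3)%Z = 1 \/ (z.1 %% 3)%Z = 2 by lia.
  by case=> [->|[->|->]] /=; lia.
(* X, Y, X + Y are odd when x is odd, y is even, x + y is even, respectively. If none were odd, 3 (2
   n) + 1 would be even; otherwise exactly two are. *)
have cP : (count (fun z => P z && ((z.1 %% 2)%Z == 1)) (zbox N) +
  count (fun z => P z && ((z.2 %% 2)%Z == 0)) (zbox N) +
  count (fun z => P z && (((z.1 + z.2) %% 2)%Z == 0)) (zbox N) = 2 * count P (zbox N))%N.
  elim: (zbox N) => //= -[x y] s; rewrite mulnDr => <- /=.
  case Pz: (P (x, y)) => /=; last by lia.
  have /core_expP e := Pz.
  suff : (nat_of_bool (x %% 2 == 1)%Z + nat_of_bool (y %% 2 == 0)%Z + nat_of_bool ((x + y) %% 2 == 0)%Z = 2)%N by lia.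
  have [s1 [b1 [ex eb1]]] : exists s1 b1 : int, x = 2 * s1 + b1 /\ (b1 = 0 \/ b1 = 1).
    by exists (x %/ 2)%Z, (x %% 2)%Z; lia.
  have [s2 [b2 [ey eb2]]] : exists s2 b2 : int, y = 2 * s2 + b2 /\ (b2 = 0 \/ b2 = 1).
    by exists (y %/ 2)%Z, (y %% 2)%Z; lia.
  have : ~ (b1 = 0 /\ b2 = 1).
    by case=> b10 b21; move: e; rewrite ex ey b10 b21; lia.
  have -> : (x %% 2)%Z = b1 by lia.
  have -> : (y %% 2)%Z = b2 by lia.
  have -> : ((x + y) %% 2)%Z = if b1 == b2 then 0 else 1 by case: ifP; lia.
  by clear - eb1 eb2; case: eb1 eb2 => -> [] -> // nb; case: nb.
have : (2 * count P (zbox N) = count Q (zbox N))%N by rewrite -cP -cQ c1 c2 c3.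
by rewrite /P /Q; lia.
Qed.

(** Multiplying (X, Y) by -2 preserves the residues 0 and 1 mod 3 and multiplies 3 E + 1 by 4. *)
Lemma core_exp_dbl s t : core_exp (- 2 * s, - 2 * t - 1) = (4 * core_exp (s, t) + 1)%N.
Proof. by apply/eqP; rewrite -eqz_nat PoszD PoszM !core_expE; apply/eqP; ring. Qed.

(** For odd E the value X^2 + X Y + Y^2 = 3 E + 1 is even, so X and Y are both even and the doubling
    can be undone. *)
Lemma core_exp_odd x y n : core_exp (x, y) = (2 * n + 1)%N ->
  exists s t, [/\ x = - 2 * s, y = - 2 * t - 1 & n = (2 * core_exp (s, t))%N].
Proof.
move=> e; suff [s [t [ex ey]]] : exists s t, x = - 2 * s /\ y = - 2 * t - 1.
  by exists s, t; split=> //; move: e; rewrite ex ey core_exp_dbl; lia.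
move: e => /eqP/core_expP e.
have [s1 [b1 [ex eb1]]] : exists s1 b1 : int, x = 2 * s1 + b1 /\ (b1 = 0 \/ b1 = 1).
  by exists (x %/ 2)%Z, (x %% 2)%Z; lia.
have [s2 [b2 [ey eb2]]] : exists s2 b2 : int, y = 2 * s2 + b2 /\ (b2 = 0 \/ b2 = 1).
  by exists (y %/ 2)%Z, (y %% 2)%Z; lia.
exists (- s1), (- s2 - 1).
suff : b1 = 0 /\ b2 = 1 by lia.
by subst x y; case: eb1 eb2 e => -> [] ->; lia.
Qed.

Lemma core3_odd n : core3 (2 * n + 1)%N = if (2 %| n)%N then core3 (n %/ 2)%N else 0.
Proof.
pose N := (4 * n + 4)%N.
rewrite (@core3_count _ N); last by rewrite /N; lia.
case: ifP => [/dvdnP[k ek]|ndvd]; last first.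
  rewrite (eq_count (a2 := pred0)) ?count_pred0 // => -[x y] /=.
  apply/negP => /eqP/core_exp_odd[s [t [_ _ en]]].
  by move/negP: ndvd; apply; rewrite en dvdn_mulr.
rewrite ek mulnK // (@core3_count _ N); last by rewrite /N; lia.
congr Posz; apply: (count_bij (h := fun z => (- (z.1 %/ 2)%Z, - ((z.2 + 1) %/ 2)%Z))
  (h' := fun z => (- 2 * z.1, - 2 * z.2 - 1))); rewrite ?zbox_uniq // => -[x y] _ /eqP /= e.
  have [s [t [-> -> en]]] := core_exp_odd e.
  have -> : (- 2 * s %/ 2)%Z = - s by lia.
  have -> : ((- 2 * t - 1 + 1) %/ 2)%Z = - t by lia.
  have est : core_exp (s, t) = k by lia.
  rewrite !opprK est mem_zbox /=; split=> //.
  by have [] := @core_exp_bound s t k; rewrite ?est //; lia.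
have e2 : core_exp (- 2 * x, - 2 * y - 1) = (4 * k + 1)%N by rewrite core_exp_dbl e.
split; last by congr (_, _); lia.
- rewrite mem_zbox /=.
  by have [] := @core_exp_bound (- 2 * x) (- 2 * y - 1) (4 * k + 1); rewrite ?e2 //; lia.
- by rewrite e2; lia.
Qed.

(** Ramanujan's psi(q), the sum of q^(k (k + 1) / 2) over k >= 0. *)
Definition psi : fps int := f 2 ^+ 2 * g 1.
Definition theta12 : fps int := f 2 * f 3 ^+ 2 * g 1 * g 6.

(** The classical 2-dissection of f_3^3 / f_1, with odd part q f_12^3 / f_4. *)
Lemma core3_dissection : core3 = dilate 2 (psi * theta12) + qX 1 * dilate 4 core3.
Proof.
have dbl (a b : fps int) : 2 * a = 2 * b -> a = b.
  move=> e; apply/funext => n; have := congr1 (fun c : fps int => c n) e.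
  by rewrite /= !mulr2n !mulrDl !mul1r !fpsD; lia.
apply/funext => n; rewrite fpsD qXM /dilate.
have [[m en]|[m en]] : (exists m, n = 2 * m)%N \/ (exists m, n = 2 * m + 1)%N.
- by case: (boolP (odd n)) => on; [right|left]; exists n./2; lia.
- rewrite en dvdn_mulr // mulKn //.
  have -> : (if (1 <= 2 * m)%N then if (4 %| 2 * m - 1)%N then core3 ((2 * m - 1) %/ 4)%N else 0
    else 0) = 0 by case: ifP => // m0; rewrite ifF //; lia.
  rewrite addr0.
  have : 2 * core3 (2 * m)%N = 2 * (psi * theta12) m.
    rewrite core3_even theta_psi theta_12 -/psi -/theta12 -mulrA.
    by rewrite !mulr2n !mulrDl !mul1r fpsD.
  by lia.
rewrite en core3_odd [X in _ = X + _]ifF ?add0r; last lia.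
rewrite addn1 /= subn1 /= (_ : (4 %| 2 * m) = (2 %| m))%N; last by lia.
by case: ifP => // /dvdnP[k ->]; congr core3; lia.
Qed.

(** * Positivity *)

Definition nonneg (a : fps int) := forall n, 0 <= a n.

Lemma nonnegM a b : nonneg a -> nonneg b -> nonneg (a * b).
Proof. by move=> a0 b0 n; rewrite fpsM sumr_ge0 // => i _; rewrite mulr_ge0. Qed.

Lemma nonneg1 : nonneg 1.
Proof. by move=> n; rewrite fps1. Qed.

Lemma nonnegX a k : nonneg a -> nonneg (a ^+ k).
Proof.
by move=> a0; elim: k => [|k IHk]; [exact: nonneg1 | rewrite exprS; apply: nonnegM].
Qed.

Lemma nonneg_dilate j a : nonneg a -> nonneg (dilate j a).
Proof. by move=> a0 n; rewrite /dilate; case: ifP. Qed.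

Lemma mul_pos (a b : fps int) i j n : nonneg a -> nonneg b -> 0 < a i -> 0 < b j -> n = (i + j)%N ->
  0 < (a * b) n.
Proof.
move=> a0 b0 ai bj ->; rewrite fpsM (bigD1 (inord i)) //= inordK ?ltnS ?leq_addr //.
rewrite addKn ltr_pwDl ?mulr_gt0 // sumr_ge0 // => k _; exact: mulr_ge0.
Qed.

Lemma exp_pos0 (a : fps int) k : a 0%N = 1 -> (a ^+ k) 0%N = 1.
Proof.
move=> a0; elim: k => // k IHk; rewrite exprS fpsM big_ord1 a0 mul1r; exact: IHk.
Qed.

Lemma f0 j : f j 0%N = 1. Proof. exact: euler_fps0. Qed.

Lemma g0 j : g j 0%N = 1.
Proof.
have := congr1 (fun a : fps int => a 0%N) (fgK j).
by rewrite /= fpsM big_ord1 f0 mul1r.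
Qed.

Lemma g1_pos n : 0 < g 1 n.
Proof.
have geom k : (1 - qX k.+1) * dilate k.+1 (fun _ => 1) = 1.
  apply/funext => i; rewrite mulrBl mul1r fpsD fpsN qXM fps1 /dilate.
  have [le_ki|lt_ik] := leqP k.+1 i.
    by rewrite dvdn_subl // subrr; case: i le_ki.
  by rewrite subr0; case: i lt_ik => // i lt_ik; rewrite ifF // gtnNdvd.
have [h ph h0] : exists2 h : fps int,
    \prod_(1 <= k < n.+2) (1 - qX (1 * k)) * h = 1 & forall i, 0 < h i.
  elim: n => [|n [h ph h0]].
    (* 1 / (1 - q) has all coefficients equal to 1, so the further geometric series cannot destroy
       positivity. *)
    exists (dilate 1 (fun _ => 1)); first by rewrite big_nat1 mul1n.
    by move=> i; rewrite /dilate dvd1n.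
  exists (h * dilate n.+2 (fun _ => 1)); first by rewrite big_nat_recr //= mul1n mulrACA ph geom mulr1.
  move=> i; apply: (@mul_pos _ _ i 0); rewrite ?addn0 //; first by move=> m; apply: ltW.
  by apply: nonneg_dilate.
by rewrite -(@g_prod 1 n.+1 h isT ph n (leqnSn n)).
Qed.

Lemma g_nonneg j : (0 < j)%N -> nonneg (g j).
Proof.
by move=> j0; rewrite -[j]muln1 -dilate_g //; apply: nonneg_dilate => n; apply/ltW/g1_pos.
Qed.

Lemma g_pos j n : (0 < j)%N -> 0 < g j (j * n)%N.
Proof. by move=> j0; rewrite -{1}[j]muln1 -dilate_g // dilate_nmul // g1_pos. Qed.

Lemma theta1_nonneg a b : nonneg (theta 1 a b).
Proof. by move=> n; rewrite addr_ge0 // sumr_ge0 // => k _; rewrite expr1n mul1r. Qed.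

Lemma theta1_pos a b x : (0 < a + b)%N -> 0 < theta 1 a b (zexp a b x).
Proof.
move=> ab; rewrite (theta_zr ab (ltnSn _)).
rewrite (bigD1_seq x) ?zr_uniq ?mem_zr ?zexp_ge //= eqxx ltr_pwDl // sumr_ge0 //.
Qed.

(** For odd a and b the exponent of the term of index k has the parity of k. *)
Lemma twist_theta a b : odd a -> odd b -> twist (theta (-1) a b) = theta 1 a b.
Proof.
move=> oa ob; apply/funext => n; rewrite /twist /theta mulrDr !mulr_sumr.
have sgn c d k : odd c -> odd d ->
    (-1) ^+ n * ((-1) ^+ k * (n == theta_exp c d k)%:R) =
    1 ^+ k * (n == theta_exp c d k)%:R :> int.
  move=> oc od; case: eqP => [->|]; rewrite ?mulr0 // !mulr1 expr1n.
  by rewrite -exprD -signr_odd /theta_exp !(oddD, oddM) oc od /= addbb.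
by congr (_ + _); apply: eq_bigr => k _; apply: sgn.
Qed.

Lemma twistX k : twist (qX k) = cst ((-1) ^+ k) * qX k.
Proof. by apply/funext => n; rewrite cstM /twist /qX; case: eqP => [->|]; rewrite ?mulr0. Qed.

Lemma eqfps_twist M a b : eqfps M a b -> eqfps M (twist a) (twist b).
Proof. by move=> ab n le_n; rewrite /twist ab. Qed.

(** * The series (-q; q^2) of partitions into distinct odd parts *)

Definition dodd : fps int := twist (f 1 * g 2).

Lemma dodd_prod n : eqfps n (rprod 1 1 2 n) dodd.
Proof.
have E : eqfps n (rprod (-1) 2 2 n) (f 2).
  by have := @prod_minus_f 2 1 n n; rewrite big_ord1; apply; rewrite ?mul1n.
have F := @prod_minus_f 1 2 n n isT.
rewrite big_ord_recr big_ord1 /= in F.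
have le_n : (n <= 2 * n)%N by rewrite leq_pmull.
have /eqfps_twist := eqfps_div (F le_n) E (fgK 2).
rewrite -/dodd rmorph_prod /=; congr (eqfps _ _ _); apply: eq_bigr => j _.
rewrite rmorphD rmorphM rmorph1 cstN1 rmorphN1 /= twistX cst1.
by rewrite -signr_odd oddD mul1n oddM /= expr1 cstN1 !mulN1r opprK mul1r.
Qed.

Lemma dodd_eta : dodd = f 2 ^+ 2 * g 1 * g 4.
Proof.
apply/funext => n; rewrite -(dodd_prod (leqnn n)).
have E : eqfps n (rprod 1 2 2 n) (f 4 * g 2).
  by have := @prod_plus_f 2 1 n n; rewrite big_ord1; apply; rewrite ?mul1n.
have F := @prod_plus_f 1 2 n n isT.
rewrite big_ord_recr big_ord1 /= in F.
have le_n : (n <= 2 * n)%N by rewrite leq_pmull.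
have uv : f 4 * g 2 * (f 2 * g 4) = 1.
  by transitivity ((f 4 * g 4) * (f 2 * g 2)); [ring | rewrite !fgK mulr1].
rewrite (eqfps_div (F le_n) E uv (leqnn n)).
by have -> : f 2 ^+ 2 * g 1 * g 4 = f 2 * g 1 * (f 2 * g 4) by ring.
Qed.

Lemma twist_f1 : twist (f 1) = f 2 ^+ 3 * g 1 * g 4.
Proof.
have tf2 : twist (f 2) = f 2 by rewrite -[f 2](@dilate_f 2 1) // twist_dilate_even.
have -> : f 1 = f 1 * g 2 * f 2 by rewrite -mulrA [g 2 * _]mulrC fgK mulr1.
by rewrite rmorphM /= -/dodd dodd_eta tf2; ring.
Qed.

Lemma rprod_nonneg i p n : nonneg (rprod 1 i p n).
Proof.
apply: (big_ind nonneg) => [|a b|j _]; [exact: nonneg1 | exact: nonnegM|].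
by move=> k; rewrite fpsD cst1 mul1r fps1 addr_ge0.
Qed.

Lemma dodd_nonneg : nonneg dodd.
Proof. by move=> n; rewrite -(dodd_prod (leqnn n)) rprod_nonneg. Qed.

(* (1 - q^2) (D - 1) has nonnegative coefficients for D = (-q; q^2): raising the
   largest part of a partition into distinct odd parts by 2 is injective. *)
Lemma rprod_odd_diff n : (rprod 1 1 2 n.+1 - 1) * (1 - qX 2) =
  qX 1 + \sum_(k < n) qX (4 * k + 4) * rprod 1 1 2 k - qX (2 * n + 3) * rprod 1 1 2 n.
Proof.
have rS k : rprod 1 1 2 k.+1 = rprod 1 1 2 k * (1 + qX (1 + 2 * k)).
  by rewrite /rprod big_ord_recr /= cst1 mul1r.
have r0 : rprod 1 1 2 0 = 1 by rewrite /rprod big_ord0.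
elim: n => [|n IHn].
  by rewrite big_ord0 rS r0 muln0 addn0 add0n (qXD 1 2); ring.
have -> : (rprod 1 1 2 n.+2 - 1) * (1 - qX 2) = (rprod 1 1 2 n.+1 - 1) * (1 - qX 2) +
   rprod 1 1 2 n.+1 * qX (1 + 2 * n.+1) * (1 - qX 2) by rewrite [rprod 1 1 2 n.+2]rS; ring.
rewrite IHn big_ord_recr /=.
have -> : (2 * n.+1 + 3 = (2 * n + 3) + 2)%N by lia.
have -> : (1 + 2 * n.+1 = 2 * n + 3)%N by lia.
have -> : (4 * n + 4 = (2 * n + 3) + (1 + 2 * n))%N by lia.
by rewrite [rprod 1 1 2 n.+1]rS [qX (2 * n + 3 + 2)]qXD [qX (2 * n + 3 + (1 + 2 * n))]qXD; ring.
Qed.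

Lemma dodd_diff n : dodd n.+2 - (dodd n - (n == 0%N)%:R) =
  (\sum_(k < n.+2) qX (4 * k + 4) * rprod 1 1 2 k) n.+2.
Proof.
have := congr1 (fun a : fps int => a n.+2) (rprod_odd_diff n.+2).
rewrite /= mulrBr mulr1 mulrC ![(_ + _ : fps int) _]fpsD !fpsN !qXM /= !fpsD !fpsN !fps1.
rewrite subr0 subSS subSS subn0 /= {1}/qX /= add0r.
rewrite !(@dodd_prod n.+3) //; last lia.
(* The boundary term of [rprod_odd_diff] starts in degree 2 (n + 2) + 3, beyond n + 2. *)
by rewrite ifF ?subr0 //; lia.
Qed.

Lemma dodd_mono n : (0 < n)%N -> dodd n <= dodd n.+2.
Proof.
move=> n0; have := dodd_diff n; rewrite (gtn_eqF n0) subr0 fps_sum => e.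
rewrite -subr_ge0 e sumr_ge0 // => k _; rewrite qXM; case: ifP => // _; exact: rprod_nonneg.
Qed.

Lemma dodd0 : dodd 0%N = 1.
Proof. by rewrite -(dodd_prod (leqnn 0)) /rprod big_ord0. Qed.

Lemma dodd1 : dodd 1%N = 1.
Proof.
rewrite -(dodd_prod (leqnn 1)) /rprod big_ord1 fpsD fps1 cst1 mul1r add0r.
by [].
Qed.

Lemma dodd4 : 1 <= dodd 4%N.
Proof.
have := dodd_diff 2; rewrite subr0 big_ord_recl fpsD fps_sum.
have -> : (qX (4 * ord0 (n' := 3) + 4) * rprod 1 1 2 (ord0 (n' := 3))) 4%N = 1.
  by rewrite qXM /= /rprod big_ord0.
move=> e; have : 0 <= dodd 4%N - dodd 2%N - 1.
  rewrite e addrC addKr sumr_ge0 // => k _; rewrite qXM; case: ifP => // _.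
  exact: rprod_nonneg.
by rewrite subr_ge0 lerBrDr => h; apply: le_trans h; rewrite lerDl dodd_nonneg.
Qed.

(** The step from d_0 = 1 to d_2 = 0 is the only bad one: longer even steps from 0 are compared
    through d_4 >= 1. *)
Lemma dodd_step k h : (0 < k)%N || (h != 1)%N -> dodd k <= dodd (k + 2 * h)%N.
Proof.
have mono m i : (0 < m)%N -> dodd m <= dodd (m + 2 * i)%N.
  move=> m0; elim: i => [|i IHi]; first by rewrite muln0 addn0.
  rewrite mulnS addnCA add2n; apply: (le_trans IHi); apply: dodd_mono; lia.
case: k => [|k _]; last exact: mono.
case: h => [|[|h]] // _; rewrite dodd0; apply: le_trans dodd4 _.
have -> : (0 + 2 * h.+2 = 4 + 2 * h)%N by lia.
exact: mono.
Qed.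

Lemma dodd_ge1 n : n != 2%N -> 1 <= dodd n.
Proof.
move=> n2; have [[m en]|[m en]] : (exists m, n = 2 * m)%N \/ (exists m, n = 1 + 2 * m)%N.
- by case: (boolP (odd n)) => on; [right|left]; exists n./2; lia.
- by rewrite en -dodd0 -[(2 * m)%N]add0n dodd_step //; lia.
- by rewrite en -dodd1 dodd_step.
Qed.

(** * The product of (-q; q^2) with psi(q^3)^3 / psi(q) at -q *)

Lemma dilate_sum d (a : fps int) N : (0 < d)%N ->
  eqfps N (dilate d a) (\sum_(u < N.+1) cst (a u) * qX (d * u)).
Proof.
move=> d0 n le_nN; rewrite fps_sum.
rewrite (eq_bigr (fun u : 'I_N.+1 => a u * (n == d * u)%N%:R)) => [|u _]; last by rewrite cstM.
rewrite /dilate; case: ifP => [/dvdnP[k ek]|ndvd].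
  have lt_k : (k < N.+1)%N by rewrite ltnS; nia.
  rewrite ek mulnK // (bigD1 (Ordinal lt_k)) //= mulnC eqxx mulr1 big1 ?addr0 // => i.
  by rewrite -val_eqE /= eqn_pmul2l // eq_sym => /negbTE ->; rewrite mulr0.
rewrite big1 // => u _; case: eqP => [e|]; rewrite ?mulr0 //.
by rewrite e dvdn_mulr in ndvd.
Qed.

Lemma mul_dilate_coef (b a : fps int) c d n : (0 < d)%N ->
  (b * qX c * dilate d a) n =
  \sum_(u < n.+1) a u * (if (c + d * u <= n)%N then b (n - (c + d * u))%N else 0).
Proof.
move=> d0; rewrite (@eqfpsM n _ (b * qX c) _ _ _ (dilate_sum a d0)) // mulr_sumr fps_sum.
apply: eq_bigr => u _.
have -> : b * qX c * (cst (a u) * qX (d * u)) = cst (a u) * (qX (c + d * u) * b).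
  by rewrite qXD; ring.
by rewrite cstM qXM.
Qed.

Definition psi_psi3 : fps int := psi * dilate 3 psi.

Lemma psi_nonneg : nonneg psi.
Proof.
move=> n; have := theta1_nonneg 0 1 n.
by rewrite theta_psi -/psi mulr2n mulrDl mul1r fpsD; lia.
Qed.

Lemma psi_pos x : 0 < psi (zexp 0 1 x).
Proof.
have := @theta1_pos 0 1 x isT.
by rewrite theta_psi -/psi mulr2n mulrDl mul1r fpsD; lia.
Qed.

Lemma psi0 : psi 0%N = 1.
Proof. by rewrite /psi expr2 !fpsM !big_ord1 /= fpsM big_ord1 !f0 g0. Qed.

Lemma psi_psi3_nonneg : nonneg psi_psi3.
Proof. by apply: nonnegM; last apply: nonneg_dilate; apply: psi_nonneg. Qed.

Lemma psi_psi30 : psi_psi3 0%N = 1.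
Proof. by rewrite /psi_psi3 fpsM big_ord1 /dilate /= psi0. Qed.

Lemma psi_psi31 : 0 < psi_psi3 1%N.
Proof.
rewrite /psi_psi3; apply: (@mul_pos _ _ 1 0) => //.
- exact: psi_nonneg.
- exact/nonneg_dilate/psi_nonneg.
- exact: (psi_pos 2).
- by rewrite /dilate /= psi0.
Qed.

(** Term by term in u, the indices into [dodd] differ by m + 2 m u, which is even, so [dodd_step]
    applies. Its exception needs m + 2 m u = 2 and lower index 0, that is m = 2, u = 0, n = 3. *)
Lemma bracket_ge m n : (1 < m)%N -> ~~ odd m -> 
  - ((m == 2) && (n == 3))%N%:R <=
  (dodd * qX m.-1 * dilate (2 * m) psi_psi3) n -
  (dodd * qX (2 * m).-1 * dilate (4 * m) psi_psi3) n.
Proof.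
move=> m1 evm; rewrite !mul_dilate_coef ?muln_gt0 ?(ltnW m1) // -sumrB.
have term (u : nat) : ~~ [&& u == 0, m == 2 & n == 3]%N -> 0 <= psi_psi3 u *
     (if (m.-1 + 2 * m * u <= n)%N then dodd (n - (m.-1 + 2 * m * u))%N else 0) -
   psi_psi3 u * (if ((2 * m).-1 + 4 * m * u <= n)%N
     then dodd (n - ((2 * m).-1 + 4 * m * u))%N else 0).
  move=> cond; rewrite -mulrBr mulr_ge0 ?psi_psi3_nonneg // subr_ge0.
  case: (leqP ((2 * m).-1 + 4 * m * u) n) => le_n; last by case: ifP => // _; apply: dodd_nonneg.
  rewrite ifT; last nia.
  have [k em] : exists k, m = (2 * k)%N by exists m./2; lia.
  have [h eh] : exists h, (m + 2 * m * u = 2 * h)%N by exists (k + m * u)%N; rewrite mulnDr -em mulnA.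
  have -> : (n - (m.-1 + 2 * m * u) = n - ((2 * m).-1 + 4 * m * u) + 2 * h)%N by nia.
  apply: dodd_step; rewrite -implyNb; apply/implyP => n0.
  by apply: contra cond => /eqP h1; apply/and3P; split; apply/eqP; nia.
case: (boolP ((m == 2) && (n == 3))%N) => [/andP[/eqP em /eqP en]|cond].
  rewrite big_ord_recl /= -[X in X <= _]addr0; apply: lerD; last first.
    by apply: sumr_ge0 => u _; apply: term.
  by rewrite em en /= psi_psi30 !mul1r dodd0 -[X in X <= _]add0r lerD2r dodd_nonneg.
by rewrite mulr0n oppr0; apply: sumr_ge0 => u _; apply: term; rewrite negb_and cond orbT.
Qed.

(* psi(q^3)^3 / psi(q) *)
Definition psi_quot : fps int := f 6 ^+ 6 * f 1 * g 3 ^+ 3 * g 2 ^+ 2.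

Lemma twist_even_g j : ~~ odd j -> (0 < j)%N -> twist (g j) = g j.
Proof. by move=> evj j0; rewrite -[j]muln1 -dilate_g // twist_dilate_even. Qed.

Lemma twist_g1 : twist (g 1) = g 2 ^+ 3 * f 1 * f 4.
Proof.
apply: (@inv_uniq _ (twist (f 1))); first by rewrite -rmorphM fgK rmorph1.
rewrite twist_f1.
transitivity ((f 2 * g 2) ^+ 3 * (f 1 * g 1) * (f 4 * g 4)); first by ring.
by rewrite !fgK expr1n !mulr1.
Qed.

Lemma twist_f3 : twist (f 3) = f 6 ^+ 3 * g 3 * g 12.
Proof.
rewrite -[f 3](@dilate_f 3 1) // twist_dilate_odd // twist_f1 !(rmorphXn, rmorphM) /=.
by rewrite dilate_f // !dilate_g.
Qed.

(* For C = f_3^3 / f_1 the series psi(q^3)^3 / psi(q) is C(-q) C(q^4) / C(q^2),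
   and core3_dissection computes C(-q). *)
Lemma psi_quot_dissection : psi_quot = dilate 2 psi_psi3 - qX 1 * dilate 2 psi_quot.
Proof.
have e1 := congr1 twist core3_dissection.
rewrite rmorphD rmorphM /= !twist_dilate_even // twistX expr1 cstN1 mulN1r in e1.
have twC : twist core3 = f 6 ^+ 9 * g 3 ^+ 3 * g 12 ^+ 3 * (g 2 ^+ 3 * f 1 * f 4).
  by rewrite /core3 !(rmorphXn, rmorphM) /= twist_f3 twist_g1; ring.
have d4 : dilate 4 core3 = f 12 ^+ 3 * g 4.
  by rewrite /core3 !(rmorphXn, rmorphM) /= dilate_f // dilate_g.
have dA : dilate 2 (psi * theta12) = f 4 ^+ 2 * g 2 * (f 4 * f 6 ^+ 2 * g 2 * g 12).
  by rewrite /psi /theta12 !(rmorphXn, rmorphM) /= !dilate_f // !dilate_g.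
have dU : dilate 2 psi_psi3 = f 4 ^+ 2 * g 2 * (f 12 ^+ 2 * g 6).
  by rewrite /psi_psi3 /psi !(rmorphXn, rmorphM) /= !dilate_f // !dilate_g // !dilate_f // !dilate_g.
have dT : dilate 2 psi_quot = f 12 ^+ 6 * f 2 * g 6 ^+ 3 * g 4 ^+ 2.
  by rewrite /psi_quot !(rmorphXn, rmorphM) /= !dilate_f // !dilate_g.
have e2 : psi_quot = twist core3 * dilate 4 core3 * (g 6 ^+ 3 * f 2).
  rewrite twC d4 /psi_quot.
  transitivity (f 6 ^+ 6 * f 1 * g 3 ^+ 3 * g 2 ^+ 2 * (f 6 * g 6) ^+ 3 * (f 12 * g 12) ^+ 3 *
    (f 4 * g 4) * (f 2 * g 2)); last by ring.
  by rewrite !fgK !expr1n !mulr1.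
rewrite [LHS]e2 e1 mulrDl mulrDl; congr (_ + _).
  rewrite dA d4 dU.
  transitivity (f 4 ^+ 2 * g 2 * (f 12 ^+ 2 * g 6) * ((f 4 * g 4) * (f 6 * g 6) ^+ 2 *
    (f 2 * g 2) * (f 12 * g 12))); first by ring.
  by rewrite !fgK !expr1n !mulr1.
by rewrite d4 dT; ring.
Qed.

(** Two unrollings of the dissection at q^m. The factor q^(m - 1) makes the shape recur with 4 m in
    place of m, since (m - 1) + m + 2 m = 4 m - 1. *)
Lemma dodd_psi_quot_step m : (0 < m)%N -> dodd * qX m.-1 * dilate m psi_quot =
  (dodd * qX m.-1 * dilate (2 * m) psi_psi3 - dodd * qX (2 * m).-1 * dilate (4 * m) psi_psi3) +
  dodd * qX (4 * m).-1 * dilate (4 * m) psi_quot.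
Proof.
move=> m0.
have e1 : dilate m psi_quot = dilate (2 * m) psi_psi3 - qX m * dilate (2 * m) psi_quot.
  by rewrite {1}psi_quot_dissection rmorphB [X in _ - X]rmorphM /= !dilateA // dilate_qX // muln1 mulnC.
have e2 : dilate (2 * m) psi_quot = dilate (4 * m) psi_psi3 - qX (2 * m) * dilate (4 * m) psi_quot.
  have m20 : (0 < 2 * m)%N by rewrite muln_gt0.
  rewrite {1}psi_quot_dissection rmorphB [X in _ - X]rmorphM /= !dilateA // dilate_qX //.
  by rewrite muln1 -mulnA [(m * 2)%N]mulnC mulnA.
have -> : (2 * m).-1 = (m.-1 + m)%N by lia.
have -> : (4 * m).-1 = (m.-1 + m + 2 * m)%N by lia.
by rewrite e1 e2 !qXD; ring.
Qed.

(** The tail left by one unrolling starts in degree 4 m - 1, so only finitely many brackets reach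
    q^n; k bounds the distance from m - 1 to n. *)
Lemma dodd_psi_quot_ge k m n : ~~ odd m -> (2 < m)%N -> (n < m.-1 + k)%N ->
  0 <= (dodd * qX m.-1 * dilate m psi_quot) n.
Proof.
elim: k m n => [|k IHk] m n evm m2 lt_n.
  rewrite addn0 in lt_n.
  have -> : dodd * qX m.-1 * dilate m psi_quot = qX m.-1 * (dodd * dilate m psi_quot) by ring.
  by rewrite qXM leqNgt lt_n.
rewrite dodd_psi_quot_step; last lia.
rewrite fpsD addr_ge0 //; last by apply: IHk; rewrite ?oddM //; lia.
have := @bracket_ge m n (ltnW m2) evm.
by rewrite (gtn_eqF m2) /= mulr0n oppr0.
Qed.

Lemma twist_psi_quot : twist psi_quot = dilate 2 psi_psi3 + qX 1 * dilate 2 psi_quot.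
Proof.
rewrite {1}psi_quot_dissection rmorphB [X in _ - X]rmorphM /= !twist_dilate_even // twistX expr1 cstN1.
by rewrite !mulN1r mulNr opprK.
Qed.

Lemma dodd_twist_psi_quot_pos n : 0 < (dodd * twist psi_quot) n.
Proof.
have -> : dodd * twist psi_quot = dodd * qX 0 * dilate 2 psi_psi3 + dodd * qX 1 * dilate 2 psi_quot.
  by rewrite twist_psi_quot qX0; ring.
rewrite (dodd_psi_quot_step (m := 2)) // addrA fpsD.
have h3 : 0 <= (dodd * qX (4 * 2).-1 * dilate (4 * 2) psi_quot) n.
  by apply: (@dodd_psi_quot_ge n.+1 (4 * 2) n) => //; lia.
have h2 := @bracket_ge 2 n isT isT.
apply: ltr_wpDr => //; rewrite fpsD.
have term u : 0 <= psi_psi3 u * (if (0 + 2 * u <= n)%N then dodd (n - (0 + 2 * u))%N else 0).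
  by rewrite mulr_ge0 ?psi_psi3_nonneg //; case: ifP => // _; apply: dodd_nonneg.
have p1 := psi_psi31.
rewrite mul_dilate_coef //.
(* In general the term u = 0 gives d_n >= 1. At n = 2, where d_2 = 0, the term u = 1 takes over; at
   n = 3 the terms u = 0 and u = 1 sum to at least 2, against the deficit 1 from [bracket_ge]. *)
case: (eqVneq n 2%N) h2 => [->|n2] h2.
  rewrite big_ord_recl big_ord_recl /= big_ord_recl big_ord0 /= !addr0 psi_psi30 dodd0.
  rewrite mulr0n oppr0 in h2.
  apply: ltr_wpDr => //; rewrite mul1r mulr0 addr0 mulr1.
  by apply: ltr_wpDl; [exact: dodd_nonneg | exact: p1].
case: (eqVneq n 3%N) h2 => [->|n3] h2.
  rewrite !big_ord_recl big_ord0 /= !mulr0 !addr0 psi_psi30 dodd1 !mul1r mulr1.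
  have d3 : 1 <= dodd 3%N by apply: dodd_ge1.
  apply: (@lt_le_trans _ _ (2 + -1)) => //; apply: lerD; last exact: h2.
  by apply: (@lerD _ 1 _ 1).
rewrite andbF mulr0n oppr0 in h2.
apply: ltr_wpDr => //; rewrite big_ord_recl; apply: ltr_wpDr.
  by apply: sumr_ge0 => u _; apply: term.
by rewrite /= psi_psi30 mul1r subn0; apply: lt_le_trans (dodd_ge1 n2).
Qed.

(** * Representations of integers by x^2 + y^2 + z^2 + 3 w^2 *)

Definition dsum (F : nat -> int) (n : nat) : int := \sum_(d <- divisors n) F d.

Lemma dsum_prime_pow (F : nat -> int) p k m : prime p -> ~~ (p %| m)%N -> (0 < m)%N ->
  dsum F (p ^ k * m) = \sum_(i < k.+1) \sum_(e <- divisors m) F (p ^ i * e)%N.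
Proof.
move=> p_pr pm m0; have p0 := prime_gt0 p_pr.
have pk0 : (0 < p ^ k * m)%N by rewrite muln_gt0 expn_gt0 p0.
have nd e : (e %| m)%N -> (0 < e)%N && ~~ (p %| e)%N.
  by move=> em; rewrite (dvdn_gt0 m0 em) (contra _ pm) // => /dvdn_trans; apply.
have lg i e : (e %| m)%N -> logn p (p ^ i * e) = i.
  case/nd/andP => e0 pe; rewrite lognM ?expn_gt0 ?p0 // pfactorK //.
  by rewrite lognE p_pr e0 (negbTE pe) addn0.
transitivity (\sum_(d <- [seq (p ^ i * e)%N | i <- iota 0 k.+1, e <- divisors m]) F d).
  apply: perm_big; apply: uniq_perm; first exact: divisors_uniq.
    apply: allpairs_uniq; rewrite ?iota_uniq ?divisors_uniq //.
    move=> z z' hz hz'; case/allpairsP: hz => -[i e] [_ em ->].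
    case/allpairsP: hz' => -[j e'] [_ em' ->] /= eq; rewrite /= in em em'.
    rewrite -dvdn_divisors // in em; rewrite -dvdn_divisors // in em'.
    have ij := congr1 (logn p) eq; rewrite !lg // in ij.
    move: eq; rewrite ij => /eqP; rewrite eqn_pmul2l ?expn_gt0 ?p0 // => /eqP ->.
    by [].
  move=> d; rewrite -dvdn_divisors //; apply/idP/allpairsP => [dn|[[i e] [ik em ->]]]; last first.
    rewrite mem_iota /= in ik; rewrite /= -dvdn_divisors // in em; apply: dvdn_mul => //; apply: dvdn_exp2l.
    exact: ik.
  have d0 : (0 < d)%N := dvdn_gt0 pk0 dn.
  have [e pe de] := pfactor_coprime p_pr d0.
  exists (logn p d, e); rewrite mem_iota /= add0n ltnS mulnC -de; split=> //.
    have /(dvdn_leq_log p pk0) := dn.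
    by have := lg k m (dvdnn m) => ->.
  rewrite -dvdn_divisors //.
  have : (e %| p ^ k * m)%N by apply: dvdn_trans dn; rewrite de dvdn_mulr.
  by rewrite Gauss_dvdr // coprime_sym coprimeXl.
rewrite big_allpairs_dep -(big_mkord xpredT (fun i => \sum_(e <- divisors m) F (p ^ i * e)%N)).
by rewrite /index_iota subn0.
Qed.

Lemma prime_pow_ind (P : nat -> Prop) : P 1%N ->
  (forall p k m, prime p -> ~~ (p %| m)%N -> (0 < m)%N -> (0 < k)%N -> P m -> P (p ^ k * m)%N) ->
  forall n, (0 < n)%N -> P n.
Proof.
move=> P1 Pp n; elim/ltn_ind: n => n IHn n0.
case: (ltnP 1 n) => [n1|n1]; last by have -> : n = 1%N by lia.
have p_pr := pdiv_prime n1; set p := pdiv n in p_pr.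
have [m pm en] := pfactor_coprime p_pr n0.
have k0 : (0 < logn p n)%N by rewrite logn_gt0 mem_primes p_pr n0 pdiv_dvd.
have m0 : (0 < m)%N by rewrite en muln_gt0 in n0; case/andP: n0.
rewrite en mulnC; apply: Pp => //; first by rewrite -prime_coprime.
have lt_m : (m < m * p ^ logn p n)%N by rewrite ltn_Pmulr // -(expn0 p) ltn_exp2l ?prime_gt1.
by apply: IHn => //; rewrite -en in lt_m.
Qed.

Definition chi4 (n : nat) : int := if (n %% 4 == 1)%N then 1 else if (n %% 4 == 3)%N then -1 else 0.
Definition chi3 (n : nat) : int := if (n %% 3 == 1)%N then 1 else if (n %% 3 == 2)%N then -1 else 0.
(** The even character mod 12: 1 on the classes 1 and 11, -1 on 5 and 7. *)
Definition chi12 (n : nat) : int := chi3 n * chi4 n.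

Lemma chi4M a b : chi4 (a * b) = chi4 a * chi4 b.
Proof.
rewrite /chi4 -modnMm; have := ltn_mod a 4; have := ltn_mod b 4.
by case: (a %% 4)%N => [|[|[|[|]]]] //; case: (b %% 4)%N => [|[|[|[|]]]].
Qed.

Lemma chi3M a b : chi3 (a * b) = chi3 a * chi3 b.
Proof.
rewrite /chi3 -modnMm; have := ltn_mod a 3; have := ltn_mod b 3.
by case: (a %% 3)%N => [|[|[|]]] //; case: (b %% 3)%N => [|[|[|]]].
Qed.

Lemma chi12M a b : chi12 (a * b) = chi12 a * chi12 b.
Proof. by rewrite /chi12 chi3M chi4M mulrACA. Qed.

Lemma charX (chi : nat -> int) p i : chi 1%N = 1 ->
  (forall a b, chi (a * b)%N = chi a * chi b) -> chi (p ^ i)%N = chi p ^+ i.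
Proof. by move=> c1 cM; elim: i => // i IHi; rewrite expnS cM IHi exprS. Qed.

Lemma dsum_char (chi : nat -> int) p k m : chi 1%N = 1 ->
  (forall a b, chi (a * b)%N = chi a * chi b) -> prime p -> ~~ (p %| m)%N -> (0 < m)%N ->
  dsum chi (p ^ k * m) = (\sum_(i < k.+1) chi p ^+ i) * dsum chi m.
Proof.
move=> c1 cM p_pr pm m0; rewrite dsum_prime_pow // mulr_suml; apply: eq_bigr => i _.
by rewrite /dsum mulr_sumr; apply: eq_bigr => e _; rewrite cM charX.
Qed.

Definition twisted_sigma (n : nat) : int := dsum (fun e => chi12 e * (n %/ e)%N%:Z) n.

(** By multiplicativity it is enough to treat the factor of p^k, where the top power of p
    dominates. *)
Lemma twisted_sigma_gt0 n : (0 < n)%N -> 0 < twisted_sigma n.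
Proof.
move: n; apply: prime_pow_ind => [|p k m p_pr pm m0 _ IHm].
  by rewrite /twisted_sigma /dsum (_ : divisors 1 = [:: 1%N]) // big_seq1.
have p1 := prime_gt1 p_pr; have p0 := prime_gt0 p_pr.
suff [e1 e2] : twisted_sigma (p ^ k * m) =
   (\sum_(i < k.+1) chi12 p ^+ i * p%:Z ^+ (k - i)) * twisted_sigma m /\
   0 < \sum_(i < k.+1) chi12 p ^+ i * p%:Z ^+ (k - i) by rewrite e1 mulr_gt0.
split.
  rewrite /twisted_sigma dsum_prime_pow // mulr_suml; apply: eq_bigr => -[i /= ik] _.
  rewrite /dsum mulr_sumr big_seq [RHS]big_seq; apply: eq_bigr => e.
  rewrite -dvdn_divisors // => em; have e0 := dvdn_gt0 m0 em.
  rewrite chi12M charX //; last exact: chi12M.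
  have -> : (p ^ k * m %/ (p ^ i * e) = p ^ (k - i) * (m %/ e))%N.
    rewrite -{1}(subnK (ik : i <= k)%N) expnD -{1}(divnK em).
    have -> : (p ^ (k - i) * p ^ i * (m %/ e * e) = p ^ (k - i) * (m %/ e) * (p ^ i * e))%N by lia.
    by rewrite mulnK // muln_gt0 expn_gt0 p0.
  by rewrite PoszM -[Posz (p ^ _)]natz natrX natz; ring.
(* The factors satisfy s_(k + 1) = p s_k + chi12(p)^(k + 1), which is at least 2 - 1. *)
elim: k => [|k IHk]; first by rewrite big_ord1.
rewrite big_ord_recr /= subnn expr0 mulr1.
rewrite (eq_bigr (fun i : 'I_k.+1 => p%:Z * (chi12 p ^+ i * p%:Z ^+ (k - i)))) => [|[i /= ik] _].
  rewrite -mulr_sumr; set s := \sum_(i < _) _ in IHk *.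
  have : -1 <= chi12 p ^+ k.+1.
    have c : chi12 p = 0 \/ chi12 p = 1 \/ chi12 p = -1.
      by rewrite /chi12 /chi3 /chi4; do ?[case: ifP => _]; lia.
    case: c => [->|[->|->]]; rewrite ?expr0n ?expr1n // -signr_odd.
    by case: (odd k.+1).
  by nia.
by rewrite subSn // exprS; ring.
Qed.

(** * Integers of the form x^2 + y^2 and x^2 + 3 y^2 *)

Definition rep (D : int) (n : nat) := exists x y : int, n%:Z = x * x + D * (y * y).

Lemma repM D m n : rep D m -> rep D n -> rep D (m * n).
Proof.
move=> [x [y ex]] [z [t ez]]; exists (x * z - D * (y * t)), (x * t + y * z).
by rewrite PoszM ex ez; ring.
Qed.

Lemma rep_sqr D p k : ~~ odd k -> rep D (p ^ k).
Proof.
move=> evk; exists (p ^ k./2)%N%:Z, 0; rewrite !mulr0 addr0 -PoszM -expnD addnn.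
by have := odd_double_half k; rewrite (negbTE evk) add0n => ->.
Qed.

Lemma repX D p k : rep D p -> rep D (p ^ k).
Proof.
move=> rp; elim: k => [|k IHk]; last by rewrite expnS; apply: repM.
by exists 1, 0; rewrite !mulr0 addr0 mulr1.
Qed.

Lemma sqrt_bounds n : exists s, (s * s <= n < s.+1 * s.+1)%N.
Proof.
elim: n => [|n [s /andP[s1 s2]]]; first by exists 0%N.
by case: (ltnP n.+1 (s.+1 * s.+1)) => h; [exists s | exists s.+1]; apply/andP; split; nia.
Qed.

(** Thue's pigeonhole argument: x + r y takes equal values mod p at two of the (s + 1)^2 > p pairs
    with x, y <= s, where s^2 < p. Their difference has a = - r b mod p. *)
Lemma thue p (D r : nat) : prime p -> (p %| r * r + D)%N ->
  exists a b : int, [/\ (p %| a * a + D%:Z * (b * b))%Z, 0 < a * a + b * b,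
    a * a < p%:Z & b * b < p%:Z].
Proof.
move=> p_pr pr; have [s /andP[s1 s2]] := sqrt_bounds p.
have p0 := prime_gt0 p_pr.
have lt_s : (s * s < p)%N.
  rewrite ltn_neqAle s1 andbT; apply/eqP => e; move: p_pr; rewrite -e => p_pr.
  have s1' : (1 < s)%N by case: s p_pr {e s1 s2} => [|[|]].
  have := primeP p_pr => -[_ /(_ s (dvdn_mulr s (dvdnn s)))] /orP[/eqP|/eqP]; nia.
pose h (z : 'I_s.+1 * 'I_s.+1) := Ordinal (ltn_pmod (z.1 + r * z.2) p0).
have : ~~ injectiveb h.
  apply/negP => /injectiveP /leq_card; rewrite card_prod !card_ord; lia.
case/injectivePn => -[x1 y1] [[x2 y2] neq /(congr1 val) /= eqm].
pose a := x1%:Z - x2%:Z; pose b := y1%:Z - y2%:Z.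
have lt_sz (t1 t2 : 'I_s.+1) : (t1%:Z - t2%:Z) * (t1%:Z - t2%:Z) < p%:Z.
  have := ltn_ord t1; have := ltn_ord t2; move: (nat_of_ord t1) (nat_of_ord t2) => u1 u2 h1 h2.
  have h3 : (u1%:Z - u2%:Z) * (u1%:Z - u2%:Z) <= s%:Z * s%:Z by nia.
  by apply: (le_lt_trans h3); rewrite -PoszM ltz_nat.
exists a, b; split; [|  |exact: lt_sz|exact: lt_sz]; last first.
  have : (a != 0) || (b != 0).
    apply: contraNT neq; rewrite negb_or !negbK /a /b => /andP[/eqP ea /eqP eb].
    by apply/eqP; congr (_, _); apply: val_inj => /=; lia.
  by move: (a) (b) => a' b'; nia.
have [k ek] : exists k : int, a = - r%:Z * b + k * p%:Z.
  have e1 := divn_eq (x1 + r * y1) p; have e2 := divn_eq (x2 + r * y2) p.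
  exists (((x1 + r * y1) %/ p)%N%:Z - ((x2 + r * y2) %/ p)%N%:Z); rewrite /a /b.
  move: e1 e2; rewrite eqm; set u := (_ %/ _)%N; set v := (_ %/ _)%N; set w := (_ %% _)%N.
  by move=> e1 e2; lia.
have [l el] : exists l : int, r%:Z * r%:Z + D%:Z = l * p%:Z.
  by case/dvdnP: pr => l el; exists l%:Z; rewrite -!PoszM -PoszD el.
apply/dvdzP; exists (k * k * p%:Z - 2 * r%:Z * b * k + l * (b * b)).
rewrite ek; transitivity ((r%:Z * r%:Z + D%:Z) * (b * b) - 2 * r%:Z * b * (k * p%:Z) + k * p%:Z * (k * p%:Z)).
  by ring.
by rewrite el; ring.
Qed.

(** Otherwise X^m - 1 would have p - 1 > m roots. The cases n = 2 and n = 3 yield square roots of -1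
    and of -3. *)
Lemma Fp_non_power p m n : prime p -> (1 < n)%N -> p.-1 = (m * n)%N ->
  exists x : 'F_p, (x ^+ m) ^+ n = 1 /\ x ^+ m != 1.
Proof.
move=> p_pr n1 em; have p1 := prime_gt1 p_pr.
have m0 : (0 < m)%N by case: m em => //; lia.
have [/existsP[x /andP[x0 xm]]|/existsPn allx] :=
    boolP [exists x : 'F_p, (x != 0) && (x ^+ m != 1)].
  exists x; split=> //; rewrite -exprM -em.
  have ep : x * x ^+ p.-1 = x ^+ p by rewrite -exprS prednK ?prime_gt0.
  have := expf_card x; rewrite card_Fp // -ep => h.
  by apply: (mulfI x0); rewrite h mulr1.
pose A := [pred x : 'F_p | x != 0].
have := @max_unity_roots 'F_p m (enum A) m0.
rewrite enum_uniq -cardE => /(_ _ isT) h.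
have : (#|A| <= m)%N.
  apply: h; apply/allP => x; rewrite mem_enum inE => x0.
  by apply/unity_rootP; have := allx x; rewrite x0 negbK => /eqP.
have eA : #|A| = p.-1.
  have := cardC (pred1 (0 : 'F_p)); rewrite card1 card_Fp // => e.
  have -> : #|A| = #|predC (pred1 (0 : 'F_p))| by apply: eq_card => x; rewrite !inE.
  by apply: succn_inj; rewrite -[_.+1]/(1 + _)%N e; lia.
rewrite eA; nia.
Qed.

Lemma Fp_nat_root p (x : 'F_p) D : prime p -> x * x + D%:R = 0 ->
  exists r, (p %| r * r + D)%N.
Proof.
move=> p_pr e; exists (nat_of_ord x).
by rewrite (dvdn_pcharf (pchar_Fp p_pr)) natrD natrM natr_Zp e.
Qed.

Lemma rep1_prime p : prime p -> chi4 p = 1 -> rep 1 p.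
Proof.
move=> p_pr c4; have p1 := prime_gt1 p_pr.
have p4 : (p %% 4 = 1)%N by move: c4; rewrite /chi4; do ?case: eqP.
have e4 : p.-1 = ((p %/ 4 + p %/ 4) * 2)%N by lia.
have [x [x2 x1]] := Fp_non_power p_pr (isT : 1 < 2)%N e4.
have [r pr] : exists r, (p %| r * r + 1)%N.
  apply: (@Fp_nat_root p (x ^+ (p %/ 4)) 1) => //; rewrite -exprD.
  by move/eqP: x2; rewrite sqrf_eq1 (negbTE x1) => /eqP ->; rewrite addNr.
have [a [b [/dvdzP[k ek] ab lt_a lt_b]]] := thue p_pr pr.
exists a, b; rewrite ek.
suff -> : k = 1 by rewrite mul1r.
by nia.
Qed.

(** For a primitive cube root of unity w, 2 w + 1 is a square root of -3. Thue's pair gives a^2 + 3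
    b^2 = k p with 0 < k < 4; k = 2 is impossible mod 4, and k = 3 forces a = 3 s and p = b^2 + 3
    s^2. *)
Lemma rep3_prime p : prime p -> (3 < p)%N -> chi3 p = 1 -> rep 3 p.
Proof.
move=> p_pr p3 c3; have p1 := prime_gt1 p_pr.
have pm3 : (p %% 3 = 1)%N by move: c3; rewrite /chi3; do ?case: eqP.
have podd : (p %% 2 = 1)%N.
  by have := even_prime p_pr => -[|]; [lia | rewrite modn2 => ->].
have e3 : p.-1 = (p %/ 3 * 3)%N by lia.
have [x [x3 x1]] := Fp_non_power p_pr (isT : 1 < 3)%N e3.
set w := x ^+ (p %/ 3) in x3 x1.
have w0 : w * w + w + 1 = 0.
  have : (w - 1) * (w * w + w + 1) = 0 by transitivity (w ^+ 3 - 1); [ring | rewrite x3 subrr].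
  by move/eqP; rewrite mulf_eq0 subr_eq0 (negbTE x1) => /eqP.
have [r pr] : exists r, (p %| r * r + 3)%N.
  apply: (@Fp_nat_root p (2 * w + 1) 3) => //.
  by transitivity (4 * (w * w + w + 1)); [ring | rewrite w0 mulr0].
have [a [b [/dvdzP[k ek] ab lt_a lt_b]]] := thue p_pr pr.
have k13 : 0 < k /\ k < 4 by split; nia.
have : k = 1 \/ k = 2 \/ k = 3 by lia.
case=> [k1|[k2|k3]].
- by exists a, b; rewrite ek k1 mul1r.
- have [u eu] : exists u : int, p%:Z = 2 * u + 1 by exists (p %/ 2)%N%:Z; lia.
  have [s [c [ea ec]]] : exists s c : int, a = 2 * s + c /\ (c = 0 \/ c = 1).
    by exists (a %/ 2)%Z, (a %% 2)%Z; lia.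
  have [t [d [eb ed]]] : exists t d : int, b = 2 * t + d /\ (d = 0 \/ d = 1).
    by exists (b %/ 2)%Z, (b %% 2)%Z; lia.
  by exfalso; move: ek; rewrite k2 ea eb eu; case: ec ed => -> [] ->; lia.
have [s [c [ea ec]]] : exists s c : int, a = 3 * s + c /\ (c = 0 \/ c = 1 \/ c = 2).
  by exists (a %/ 3)%Z, (a %% 3)%Z; lia.
exists b, s; move: ek; rewrite k3 ea.
by case: ec => [->|[->|->]]; lia.
Qed.

(** At a prime with chi(p) = -1 the local factor 1 - 1 + 1 - ... vanishes for odd exponents, so a
    nonzero divisor sum leaves even powers there, which are squares. *)
Lemma rep_dsum (D : int) (chi : nat -> int) :
  chi 1%N = 1 -> (forall a b, chi (a * b)%N = chi a * chi b) ->
  (forall p, prime p -> (3 < p)%N -> chi p = 1 /\ rep D p \/ chi p = -1) ->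
  forall n, (0 < n)%N -> coprime n 6 -> dsum chi n != 0 -> rep D n.
Proof.
move=> c1 cM cP; apply: prime_pow_ind => [_ _|p k m p_pr pm m0 k0 IHm].
  by exists 1, 0; rewrite !mulr0 addr0 mulr1.
rewrite coprimeMl coprime_pexpl // => /andP[cp cm].
rewrite dsum_char // mulf_eq0 negb_or => /andP[s0 dm]; apply: repM (IHm cm dm).
have p3 : (3 < p)%N.
  have := prime_gt1 p_pr; rewrite prime_coprime // in cp.
  by case: p {p_pr pm s0} cp => [|[|[|[|]]]].
case: (cP p p_pr p3) => [[_ rp]|cp1]; first exact: repX.
apply: rep_sqr; apply: contra s0 => oddk; rewrite cp1.
have [l ->] : exists l, k.+1 = (2 * l)%N by exists k.+1./2; lia.
elim: l => [|l IHl]; first by rewrite big_ord0.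
rewrite mulnS add2n !big_ord_recr /= (eqP IHl) add0r.
by rewrite [(-1) ^+ _.+1]exprS mulN1r subrr.
Qed.

Lemma rep1_dsum n : (0 < n)%N -> coprime n 6 -> dsum chi4 n != 0 -> rep 1 n.
Proof.
apply: rep_dsum; [by []|exact: chi4M|] => p p_pr p3.
have c : (p %% 4 = 1 \/ p %% 4 = 3)%N by have [|] := even_prime p_pr; lia.
case: (c) => e; [left; split | right]; rewrite /chi4 ?e //.
by apply: rep1_prime => //; rewrite /chi4 e.
Qed.

Lemma rep3_dsum n : (0 < n)%N -> coprime n 6 -> dsum chi3 n != 0 -> rep 3 n.
Proof.
apply: rep_dsum; [by []|exact: chi3M|] => p p_pr p3.
have c : (p %% 3 = 1 \/ p %% 3 = 2)%N.
  have [p30|p30] : (p %% 3 = 0)%N \/ (p %% 3 <> 0)%N by lia.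
    have /(primeP p_pr).2 : (3 %| p)%N by apply/eqP.
    by case/orP => /eqP; lia.
  by lia.
case: (c) => e; [left; split | right]; rewrite /chi3 ?e //.
by apply: rep3_prime => //; rewrite /chi3 e.
Qed.

(** * Liouville's identity by counting quadruples *)

Definition quad := ((nat * nat) * (nat * nat))%type.

Definition nbox (n : nat) : seq (nat * nat) :=
  [seq (a, x) | a <- iota 0 n.+1, x <- iota 0 n.+1].

Definition qbox (n : nat) : seq quad := [seq (z, w) | z <- nbox n, w <- nbox n].

Lemma mem_nbox n a x : ((a, x) \in nbox n) = (a <= n)%N && (x <= n)%N.
Proof.
apply/allpairsP/andP => [[[a' x'] [ha hx]]|[ha hx]].
  by case=> -> ->; rewrite !mem_iota in ha hx.
by exists (a, x); rewrite !mem_iota.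
Qed.

Lemma mem_qbox n a x b y :
  (((a, x), (b, y)) \in qbox n) = [&& a <= n, x <= n, b <= n & y <= n]%N.
Proof.
apply/allpairsP/idP => [[[z w] [hz hw [ez ew]]]|h].
  by move: hz hw; rewrite -ez -ew !mem_nbox; lia.
by exists ((a, x), (b, y)); rewrite !mem_nbox; split=> //; lia.
Qed.

Lemma nbox_uniq n : uniq (nbox n).
Proof. by apply: allpairs_uniq; rewrite ?iota_uniq // => -[? ?] [? ?]. Qed.

Lemma qbox_uniq n : uniq (qbox n).
Proof. by apply: allpairs_uniq; rewrite ?nbox_uniq // => -[? ?] [? ?]. Qed.

(* Liouville's method.  The numbers of the next two kinds of quadruples differ
   only on their diagonals a = b resp. x = y: off these, a x + b y is rewritten
   as p j + s t with s and j divisible by 12, and (p, j, s, t) |->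
   (p - s, j, s, t + j) preserves p j + s t. *)
Definition quad_plus (n : nat) (z : quad) : bool :=
  let: ((a, x), (b, y)) := z in
  [&& a * x + b * y == n, (a %% 12 == 1) || (a %% 12 == 11), x %% 12 == (5 * a) %% 12,
      b %% 12 == a %% 12 & y %% 12 == (7 * a) %% 12]%N.

Definition quad_minus (n : nat) (z : quad) : bool :=
  let: ((a, x), (b, y)) := z in
  [&& a * x + b * y == n, (a %% 12 == 1) || (a %% 12 == 11), x %% 12 == (5 * a) %% 12,
      b %% 12 == (11 * a) %% 12 & y %% 12 == x %% 12]%N.

Definition quad_omega (n : nat) (z : quad) : bool :=
  let: ((p, j), (s, t)) := z in
  [&& p * j + s * t == n, (p %% 12 == 1) || (p %% 12 == 11), (t %% 12 == 5) || (t %% 12 == 7),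
      j %% 12 == 0, s %% 12 == 0, 0 < j & 0 < s]%N.

Lemma quad_bound n a x b y : (a * x + b * y)%N = n ->
  (0 < a -> 0 < x -> 0 < b -> 0 < y -> [&& a <= n, x <= n, b <= n & y <= n])%N.
Proof.
move=> <- a0 x0 b0 y0; apply/and4P; split.
- by apply: leq_trans (leq_addr _ _); rewrite leq_pmulr.
- by apply: leq_trans (leq_addr _ _); rewrite leq_pmull.
- by apply: leq_trans (leq_addl _ _); rewrite leq_pmulr.
- by apply: leq_trans (leq_addl _ _); rewrite leq_pmull.
Qed.

Lemma quad_omega_bound n p j s t : quad_omega n ((p, j), (s, t)) ->
  [&& p <= n, j <= n, s <= n & t <= n]%N.
Proof.
case/and4P => /eqP e hp ht /and4P[hj hs j0 s0].
have p0 : (0 < p)%N by clear - hp; lia.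
have t0 : (0 < t)%N by clear - ht; lia.
exact: quad_bound e p0 j0 s0 t0.
Qed.

Lemma quad_plus_bound n a x b y : quad_plus n ((a, x), (b, y)) ->
  [&& a <= n, x <= n, b <= n & y <= n]%N /\ [/\ 0 < a, 0 < x, 0 < b & 0 < y]%N.
Proof.
case/and5P => /eqP e ha hx hb hy.
have [a0 x0 b0 y0] : [/\ 0 < a, 0 < x, 0 < b & 0 < y]%N by clear e; split; lia.
by split; [exact: quad_bound e a0 x0 b0 y0 | split].
Qed.

Lemma quad_minus_bound n a x b y : quad_minus n ((a, x), (b, y)) ->
  [&& a <= n, x <= n, b <= n & y <= n]%N /\ [/\ 0 < a, 0 < x, 0 < b & 0 < y]%N.
Proof.
case/and5P => /eqP e ha hx hb hy.
have [a0 x0 b0 y0] : [/\ 0 < a, 0 < x, 0 < b & 0 < y]%N by clear e; split; lia.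
by split; [exact: quad_bound e a0 x0 b0 y0 | split].
Qed.

(** a x + b y = a (x - y) + (a + b) y when x > y, and symmetrically otherwise. The two cases have t
    = 5 p and t = 7 p mod 12, so the map can be inverted. *)
Lemma count_minus_off n : count (fun z => quad_minus n z && (z.1.2 != z.2.2)) (qbox n) =
  count (fun z => quad_omega n z && (z.1.1 < z.2.1)%N) (qbox n).
Proof.
apply: (count_bij (h := fun z : quad => let: ((a, x), (b, y)) := z in
    if (y < x)%N then ((a, x - y), (a + b, y))%N else ((b, y - x), (a + b, x))%N)
  (h' := fun z : quad => let: ((p, j), (s, t)) := z in
    if (t %% 12 == (5 * p) %% 12)%N then ((p, t + j), (s - p, t))%N
    else ((s - p, t), (p, t + j))%N)); rewrite ?qbox_uniq //.
- move=> [[a x] [b y]] _ /andP[qm /= nxy].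
  have [_ [a0 x0 b0 y0]] := quad_minus_bound qm.
  case/and5P: qm => /eqP e ha /eqP hx /eqP hb /eqP hy.
  have [lt_yx|le_xy] := ltnP y x.
    have [d ed] : exists d, x = (y + d)%N by exists (x - y)%N; lia.
    have q : quad_omega n ((a, d), (a + b, y))%N.
      by subst x; rewrite /quad_omega; apply/and4P; split; [apply/eqP; lia|lia|lia|apply/and4P; split; lia].
    have exy : (x - y = d)%N by lia.
    rewrite exy mem_qbox (quad_omega_bound q) q /= ifT; last by apply/eqP; lia.
    by split=> //; [lia | congr (_, _); congr (_, _); lia].
  have [d ed] : exists d, y = (x + d)%N by exists (y - x)%N; lia.
  have q : quad_omega n ((b, d), (a + b, x))%N.
    by subst y; rewrite /quad_omega; apply/and4P; split; [apply/eqP; lia|lia|lia|apply/and4P; split; lia].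
  have exy : (y - x = d)%N by lia.
  rewrite exy mem_qbox (quad_omega_bound q) q /= ifF; last by apply/eqP; lia.
  by split=> //; [lia | congr (_, _); congr (_, _); lia].
move=> [[p j] [s t]] _ /andP[/and4P[/eqP e hp ht /and4P[/eqP hj /eqP hs j0 s0]] /= lt_ps].
have [d ed] : exists d, s = (p + d)%N by exists (s - p)%N; lia.
have es : (s - p = d)%N by lia.
rewrite es; case: eqP => tp.
  have q : quad_minus n ((p, t + j), (d, t))%N.
    by subst s; apply/and5P; split; [apply/eqP; lia|lia|apply/eqP; lia|apply/eqP; lia|apply/eqP; lia].
  have [bd _] := quad_minus_bound q.
  rewrite mem_qbox bd q /= ifT; last lia.
  by split=> //; [lia | congr (_, _); congr (_, _); lia].
have q : quad_minus n ((d, t), (p, t + j))%N.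
  by subst s; apply/and5P; split; [apply/eqP; lia|lia|apply/eqP; lia|apply/eqP; lia|apply/eqP; lia].
have [bd _] := quad_minus_bound q.
rewrite mem_qbox bd q /= ifF; last lia.
by split=> //; [lia | congr (_, _); congr (_, _); lia].
Qed.

(** a x + b y = b (x + y) + (a - b) x when a > b, and symmetrically otherwise; again t mod 12
    records the case. *)
Lemma count_plus_off n : count (fun z => quad_plus n z && (z.1.1 != z.2.1)) (qbox n) =
  count (fun z => quad_omega n z && (z.2.2 < z.1.2)%N) (qbox n).
Proof.
apply: (count_bij (h := fun z : quad => let: ((a, x), (b, y)) := z in
    if (b < a)%N then ((b, x + y), (a - b, x))%N else ((a, x + y), (b - a, y))%N)
  (h' := fun z : quad => let: ((p, j), (s, t)) := z in
    if (t %% 12 == (5 * p) %% 12)%N then ((p + s, t), (p, j - t))%N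
    else ((p, j - t), (p + s, t))%N)); rewrite ?qbox_uniq //.
- move=> [[a x] [b y]] _ /andP[qm /= nab].
  have [_ [a0 x0 b0 y0]] := quad_plus_bound qm.
  case/and5P: qm => /eqP e ha /eqP hx /eqP hb /eqP hy.
  have [lt_ba|le_ab] := ltnP b a.
    have [d ed] : exists d, a = (b + d)%N by exists (a - b)%N; lia.
    have q : quad_omega n ((b, x + y), (d, x))%N.
      by subst a; rewrite /quad_omega; apply/and4P; split; [apply/eqP; lia|lia|lia|apply/and4P; split; lia].
    have exy : (a - b = d)%N by lia.
    rewrite exy mem_qbox (quad_omega_bound q) q /= ifT; last by apply/eqP; lia.
    by split=> //; [lia | congr (_, _); congr (_, _); lia].
  have [d ed] : exists d, b = (a + d)%N by exists (b - a)%N; lia.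
  have q : quad_omega n ((a, x + y), (d, y))%N.
    by subst b; rewrite /quad_omega; apply/and4P; split; [apply/eqP; lia|lia|lia|apply/and4P; split; lia].
  have exy : (b - a = d)%N by lia.
  rewrite exy mem_qbox (quad_omega_bound q) q /= ifF; last by apply/eqP; lia.
  by split=> //; [lia | congr (_, _); congr (_, _); lia].
move=> [[p j] [s t]] _ /andP[/and4P[/eqP e hp ht /and4P[/eqP hj /eqP hs j0 s0]] /= lt_tj].
have [d ed] : exists d, j = (t + d)%N by exists (j - t)%N; lia.
have es : (j - t = d)%N by lia.
rewrite es; case: eqP => tp.
  have q : quad_plus n ((p + s, t), (p, d))%N.
    by subst j; apply/and5P; split; [apply/eqP; lia|lia|apply/eqP; lia|apply/eqP; lia|apply/eqP; lia].
  have [bd _] := quad_plus_bound q.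
  rewrite mem_qbox bd q /= ifT; last lia.
  by split=> //; [lia | congr (_, _); congr (_, _); lia].
have q : quad_plus n ((p, d), (p + s, t))%N.
  by subst j; apply/and5P; split; [apply/eqP; lia|lia|apply/eqP; lia|apply/eqP; lia|apply/eqP; lia].
have [bd _] := quad_plus_bound q.
rewrite mem_qbox bd q /= ifF; last lia.
by split=> //; [lia | congr (_, _); congr (_, _); lia].
Qed.

(** The shift matches s < p with j < t. Residues mod 12 exclude p = s and t = j, so the complements
    have equal size too. *)
Lemma count_omega n : count (fun z => quad_omega n z && (z.1.1 < z.2.1)%N) (qbox n) =
  count (fun z => quad_omega n z && (z.2.2 < z.1.2)%N) (qbox n).
Proof.
have shift : count (fun z => quad_omega n z && (z.2.1 < z.1.1)%N) (qbox n) =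
  count (fun z => quad_omega n z && (z.1.2 < z.2.2)%N) (qbox n).
  apply: (count_bij (h := fun z : quad => let: ((p, j), (s, t)) := z in ((p - s, j), (s, t + j))%N)
    (h' := fun z : quad => let: ((p, j), (s, t)) := z in ((p + s, j), (s, t - j))%N));
    rewrite ?qbox_uniq //.
  - move=> [[p j] [s t]] _ /andP[/and4P[/eqP e hp ht /and4P[/eqP hj /eqP hs j0 s0]] /= lt_sp].
    have [d ed] : exists d, p = (s + d)%N by exists (p - s)%N; lia.
    have q : quad_omega n ((p - s, j), (s, t + j))%N.
      by subst p; rewrite addKn; apply/and4P; split; [apply/eqP; lia|lia|lia|apply/and4P; split; lia].
    split; [by rewrite mem_qbox (quad_omega_bound q) | | by congr (_, _); congr (_, _); lia].
    by apply/andP; split; [exact: q | move=> /=; lia].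
  move=> [[p j] [s t]] _ /andP[/and4P[/eqP e hp ht /and4P[/eqP hj /eqP hs j0 s0]] /= lt_jt].
  have [d ed] : exists d, t = (j + d)%N by exists (t - j)%N; lia.
  have q : quad_omega n ((p + s, j), (s, t - j))%N.
    by subst t; rewrite addKn; apply/and4P; split; [apply/eqP; lia|lia|lia|apply/and4P; split; lia].
  split; [by rewrite mem_qbox (quad_omega_bound q) | | by congr (_, _); congr (_, _); lia].
    by apply/andP; split; [exact: q | move=> /=; lia].
have s1 : count (quad_omega n) (qbox n) =
    (count (fun z => quad_omega n z && (z.1.1 < z.2.1)%N) (qbox n) +
     count (fun z => quad_omega n z && (z.2.1 < z.1.1)%N) (qbox n))%N.
  elim: (qbox n) => //= -[[p j] [s t]] r ->.
  case q: (quad_omega n _) => //=; have : (p != s)%N.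
    by case/and4P: q => _ hp _ /and4P[_ /eqP hs _ _]; lia.
  by lia.
have s2 : count (quad_omega n) (qbox n) =
    (count (fun z => quad_omega n z && (z.2.2 < z.1.2)%N) (qbox n) +
     count (fun z => quad_omega n z && (z.1.2 < z.2.2)%N) (qbox n))%N.
  elim: (qbox n) => //= -[[p j] [s t]] r ->.
  case q: (quad_omega n _) => //=; have : (t != j)%N.
    by case/and4P: q => _ _ ht /and4P[/eqP hj _ _ _]; lia.
  by lia.
lia.
Qed.

Lemma dsum_iota (F : nat -> int) n N : (0 < n)%N -> (n <= N)%N ->
  dsum F n = \sum_(d <- iota 0 N.+1 | (d %| n)%N) F d.
Proof.
move=> n0 le_nN; rewrite /dsum -[RHS]big_filter; apply: perm_big; apply: uniq_perm.
- exact: divisors_uniq.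
- by rewrite filter_uniq ?iota_uniq.
move=> d; rewrite -dvdn_divisors // mem_filter mem_iota add0n ltnS.
by case dn: (d %| n)%N => //=; rewrite (leq_trans (dvdn_leq n0 dn)).
Qed.

Lemma dsum_rev (F : nat -> int) n : (0 < n)%N ->
  dsum (fun d => F (n %/ d)%N) n = dsum F n.
Proof.
move=> n0; rewrite /dsum -(big_map (fun d => n %/ d)%N xpredT F); apply: perm_big.
have divdiv d : d \in divisors n -> (n %/ (n %/ d))%N = d.
  by rewrite -dvdn_divisors // => dn; rewrite divnA // mulKn.
apply: uniq_perm; rewrite ?divisors_uniq //.
  by rewrite map_inj_in_uniq ?divisors_uniq // => d e hd he eq; rewrite -(divdiv d hd) eq divdiv.
move=> d; apply/mapP/idP => [[e + ->]|hd].
  by rewrite -!dvdn_divisors // => en; apply: dvdn_div.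
exists (n %/ d)%N; last by rewrite divdiv.
by move: hd; rewrite -!dvdn_divisors // => dn; apply: dvdn_div.
Qed.

(** Half of a character: adding the values at d and n / d gives chi4(d) if n = 5 and chi3(d) if n =
    7 mod 12. *)
Definition uchar (a : nat) : int := if (a %% 12 == 1)%N then 1 else if (a %% 12 == 11)%N then -1 else 0.

Lemma dsum_uchar chi n : (0 < n)%N -> (forall d e, (d * e)%N = n -> uchar d + uchar e = chi d) ->
  2 * dsum uchar n = dsum chi n.
Proof.
move=> n0 h; rewrite mulr2n mulrDl mul1r -{2}(dsum_rev _ n0) /dsum -big_split /=.
rewrite big_seq [RHS]big_seq; apply: eq_bigr => d; rewrite -dvdn_divisors // => dn.
by apply: h; rewrite mulnC divnK.
Qed.

Lemma uchar_mod a : uchar (a %% 12) = uchar a.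
Proof. by rewrite /uchar modn_mod. Qed.

Lemma chi4_mod a : chi4 (a %% 12) = chi4 a.
Proof. by rewrite /chi4 modn_dvdm. Qed.

Lemma chi3_mod a : chi3 (a %% 12) = chi3 a.
Proof. by rewrite /chi3 modn_dvdm. Qed.

Lemma residues12 (P : nat -> nat -> bool) a b :
  all (fun i => all (P i) (iota 0 12)) (iota 0 12) -> P (a %% 12)%N (b %% 12)%N.
Proof.
by move=> /allP/(_ (a %% 12)%N) + ; rewrite mem_iota ltn_mod => /(_ isT)/allP; apply;
  rewrite mem_iota ltn_mod.
Qed.

Lemma dsum_uchar4 n : (n %% 12 = 5)%N -> 2 * dsum uchar n = dsum chi4 n.
Proof.
move=> n5; apply: dsum_uchar => [|d e en]; first lia.
have := @residues12 (fun i j => (i * j %% 12 == 5)%N ==> (uchar i + uchar j == chi4 i)) d e isT.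
by rewrite modnMm en n5 /= !uchar_mod chi4_mod => /eqP.
Qed.

Lemma dsum_uchar3 n : (n %% 12 = 7)%N -> 2 * dsum uchar n = dsum chi3 n.
Proof.
move=> n7; apply: dsum_uchar => [|d e en]; first lia.
have := @residues12 (fun i j => (i * j %% 12 == 7)%N ==> (uchar i + uchar j == chi3 i)) d e isT.
by rewrite modnMm en n7 /= !uchar_mod chi3_mod => /eqP.
Qed.

Lemma sum_nbox (R : nmodType) n (F : nat * nat -> R) :
  \sum_(z <- nbox n) F z = \sum_(a <- iota 0 n.+1) \sum_(x <- iota 0 n.+1) F (a, x).
Proof. exact: big_allpairs. Qed.

Lemma sum_iota_eq n m (c : int) : (m <= n)%N ->
  \sum_(x <- iota 0 n.+1) (if m == x then c else 0) = c.
Proof.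
move=> le_m; rewrite (bigD1_seq m) ?iota_uniq ?mem_iota //= eqxx big1 ?addr0 // => i.
by rewrite eq_sym => /negbTE ->.
Qed.

Lemma dsum_nbox (F : nat -> int) m n : (0 < m)%N -> (m <= n)%N ->
  \sum_(z <- nbox n) (if (z.1 * z.2 == m)%N then F z.1 else 0) = dsum F m.
Proof.
move=> m0 le_m; rewrite sum_nbox (dsum_iota F m0 le_m) [RHS]big_mkcond; apply: eq_bigr => a _ /=.
case: ifP => [am|nam]; last first.
  by apply: big1 => x _; case: eqP => // e; rewrite -e dvdn_mulr in nam.
have a0 := dvdn_gt0 m0 am.
rewrite (eq_bigr (fun x => if (m %/ a)%N == x then F a else 0)) => [|x _]; last first.
  have -> // : (a * x == m)%N = (m %/ a == x)%N.
  by apply/eqP/eqP => [<-|<-]; rewrite ?mulKn // mulnC divnK.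
by rewrite sum_iota_eq // (leq_trans (leq_div _ _)).
Qed.

(** When a x = 5 and b y = 7 mod 12, a nonzero uchar(a) uchar(b) is 1 for b = a and -1 for b = -a.
    As a^2 = 1, the classes of x and y are then forced, and the two kinds of quadruples appear. *)
Lemma sum_quads n : (n %% 12 = 0)%N ->
  (count (quad_plus n) (qbox n))%:Z - (count (quad_minus n) (qbox n))%:Z =
  \sum_(m <- iota 0 n.+1) (if (m %% 12 == 5)%N && (m < n)%N
    then dsum uchar m * dsum uchar (n - m) else 0).
Proof.
move=> n0.
transitivity (\sum_(z <- nbox n) \sum_(w <- nbox n)
   if (z.1 * z.2 + w.1 * w.2 == n)%N && ((z.1 * z.2) %% 12 == 5)%N
   then uchar z.1 * uchar w.1 else 0).
  rewrite -!sum1_count -!natz !natr_sum ![\sum_(_ <- _ | quad_plus _ _) _]big_mkcond.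
  rewrite ![\sum_(_ <- _ | quad_minus _ _) _]big_mkcond -sumrB /qbox big_allpairs.
  apply: eq_bigr => -[a x] _; apply: eq_bigr => -[b y] _ /=.
  case: eqP => //= e.
  (* Since 12 divides n, the class of b y follows; what remains concerns four residues mod 12 and is
     checked exhaustively. *)
  have e7 : (a * x %% 12 == 5)%N = (a * x %% 12 == 5)%N && (b * y %% 12 == 7)%N.
    by apply/idP/andP => [h|[]] //; split=> //; lia.
  rewrite e7 -[(a * x %% 12)%N]modnMm -[(b * y %% 12)%N]modnMm -[(5 * a %% 12)%N]modnMmr.
  rewrite -[(7 * a %% 12)%N]modnMmr -[(11 * a %% 12)%N]modnMmr -[uchar a]uchar_mod -[uchar b]uchar_mod.
  move: (ltn_mod a 12) (ltn_mod b 12) (ltn_mod x 12) (ltn_mod y 12).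
  move: (a %% 12)%N (b %% 12)%N (x %% 12)%N (y %% 12)%N => i k j l i12 k12 j12 l12.
  pose T i j k l := ((if [&& (i == 1) || (i == 11), j == (5 * i) %% 12, k == i & l == (7 * i) %% 12]%N
    then 1 else 0) - (if [&& (i == 1) || (i == 11), j == (5 * i) %% 12, k == (11 * i) %% 12 & l == j]%N
    then 1 else 0) == (if ((i * j) %% 12 == 5)%N && ((k * l) %% 12 == 7)%N then uchar i * uchar k else 0) :> int).
  have : all (fun i => all (fun j => all (fun k => all (fun l => T i j k l) (iota 0 12)) (iota 0 12))
    (iota 0 12)) (iota 0 12) by vm_compute.
  move=> /allP/(_ i) + ; rewrite mem_iota i12 => /(_ isT) /allP/(_ j); rewrite mem_iota j12.
  move=> /(_ isT) /allP/(_ k); rewrite mem_iota k12 => /(_ isT) /allP/(_ l).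
  by rewrite mem_iota l12 => /(_ isT) /eqP.
transitivity (\sum_(m <- iota 0 n.+1) \sum_(z <- nbox n) \sum_(w <- nbox n)
   if [&& (m %% 12 == 5), m < n, z.1 * z.2 == m & w.1 * w.2 == n - m]%N
   then uchar z.1 * uchar w.1 else 0).
  rewrite [RHS]exchange_big; apply: eq_bigr => z _ /=.
  rewrite [RHS]exchange_big; apply: eq_bigr => w _ /=.
  set p := (z.1 * z.2)%N; set q := (w.1 * w.2)%N.
  case: (leqP p n) => [le_p|lt_p]; last first.
    rewrite ifF; last lia.
    by apply/esym/big1 => m _; rewrite ifF //; lia.
  have [pq|npq] := boolP ((p + q == n)%N && (p %% 12 == 5)%N); last first.
    rewrite big1 // => m _; rewrite ifF //.
    by apply/negbTE; apply: contra npq; lia.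
  rewrite -[LHS](sum_iota_eq _ le_p); rewrite big_seq [RHS]big_seq; apply: eq_bigr => m.
  by rewrite mem_iota => hm; case: eqP => pm; [rewrite ifT | rewrite ifF] => //; lia.
rewrite big_seq [RHS]big_seq; apply: eq_bigr => m; rewrite mem_iota => hm.
case: ifP => [/andP[m5 lt_m]|nm]; last first.
  by apply: big1 => z _; apply: big1 => w _; rewrite ifF //; lia.
have m0 : (0 < m)%N by lia.
rewrite -(dsum_nbox uchar m0 (ltnW lt_m)).
have nm0 : (0 < n - m)%N by lia.
rewrite -(dsum_nbox uchar nm0 (leq_subr _ _)).
rewrite mulr_suml; apply: eq_bigr => z _; rewrite mulr_sumr; apply: eq_bigr => w _.
by rewrite m5 lt_m /=; case: eqP => _; case: eqP => _; rewrite /= ?mul0r ?mulr0.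
Qed.

(** The second component realises the weight N / e of a divisor e as a number of pairs, ready for
    injections. *)
Definition divisor_pairs (N r s : nat) (z : nat * nat) : bool :=
  [&& z.1 %| N, (z.1 %% 12 == r) || (z.1 %% 12 == s) & z.2 < N %/ z.1]%N.

Lemma sum_iota_lt N k : (k <= N.+1)%N ->
  \sum_(x <- iota 0 N.+1) (if (x < k)%N then 1 else 0) = k%:Z.
Proof.
move=> le_k; rewrite -big_mkcond.
transitivity (count (fun x => (x < k)%N) (iota 0 N.+1))%:Z.
  by rewrite -sum1_count -[RHS]natz natr_sum.
congr Posz.
have -> : iota 0 N.+1 = iota 0 k ++ iota k (N.+1 - k) by rewrite -iotaD subnKC.
have c1 : count (fun x => (x < k)%N) (iota 0 k) = k.
  rewrite -[RHS](size_iota 0); apply/eqP; rewrite -all_count; apply/allP => x.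
  by rewrite mem_iota.
have c2 : count (fun x => (x < k)%N) (iota k (N.+1 - k)) = 0%N.
  by apply/eqP; rewrite -leqn0 leqNgt -has_count; apply/hasPn => x; rewrite mem_iota; lia.
by rewrite count_cat c1 c2 addn0.
Qed.

Lemma count_divisor_pairs N r s : (0 < N)%N ->
  (count (divisor_pairs N r s) (nbox N))%:Z =
  dsum (fun e => if ((e %% 12 == r) || (e %% 12 == s))%N then (N %/ e)%N%:Z else 0) N.
Proof.
move=> N0; rewrite -sum1_count -natz natr_sum big_mkcond sum_nbox (dsum_iota _ N0 (leqnn N)).
rewrite [RHS]big_mkcond; apply: eq_bigr => e _.
transitivity (\sum_(x <- iota 0 N.+1)
    if [&& e %| N, (e %% 12 == r) || (e %% 12 == s) & x < N %/ e]%N then 1 else 0 : int).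
  by apply: eq_bigr.
case: (e %| N)%N; last by apply: big1.
case: ifP => er; last by apply: big1.
rewrite -[RHS](@sum_iota_lt N) //.
by apply: leq_trans (leq_div _ _) (leqnSn _).
Qed.

(** On the diagonal a = b = e one has x + y = 12 (N / e) with x = 5 e mod 12, so x = 12 i + (5 e mod
    12) with i < N / e. *)
Lemma count_plus_diag N : (0 < N)%N ->
  (count (divisor_pairs N 1 11) (nbox N) <=
   count (fun z => quad_plus (12 * N) z && (z.1.1 == z.2.1)) (qbox (12 * N)))%N.
Proof.
move=> N0; apply: (count_le_inj
  (h := fun z : nat * nat => let: (e, i) := z in
    ((e, 12 * i + (5 * e) %% 12), (e, 12 * (N %/ e) - (12 * i + (5 * e) %% 12)))%N)
  (h' := fun z : quad => (z.1.1, z.1.2 %/ 12)%N)); first exact: nbox_uniq.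
move=> [e i] _ /and3P[/= /dvdnP[t et] he lt_i].
have e0 : (0 < e)%N by case: e et {he lt_i} => //; rewrite muln0 => N00; rewrite N00 in N0.
have eN : (N %/ e)%N = t by rewrite et mulnK.
rewrite eN in lt_i *; set x := (12 * i + (5 * e) %% 12)%N.
have lt_x : (x < 12 * t)%N by rewrite /x; have := ltn_mod (5 * e) 12; lia.
have [y ey] : exists y, (12 * t = x + y)%N by exists (12 * t - x)%N; lia.
have -> : (12 * t - x = y)%N by lia.
have q : quad_plus (12 * N) ((e, x), (e, y)).
  apply/and5P; split.
  - by rewrite -mulnDr -ey et; apply/eqP; lia.
  - exact: he.
  - by rewrite /x; lia.
  - by [].
  - by clear - ey he lt_x; move: ey lt_x; rewrite /x; lia.
split; last by congr (_, _); rewrite /x /=; have := ltn_mod (5 * e) 12; lia.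
- by rewrite mem_qbox (quad_plus_bound q).1.
- by apply/andP; split; [exact: q | exact: eqxx].
Qed.

(** On the diagonal x = y = e one has a + b = 12 (N / e), and a = 5 e mod 12 because 5 is its own
    inverse. *)
Lemma count_minus_diag N : (0 < N)%N ->
  (count (fun z => quad_minus (12 * N) z && (z.1.2 == z.2.2)) (qbox (12 * N)) <=
   count (divisor_pairs N 5 7) (nbox N))%N.
Proof.
move=> N0; apply: (count_le_inj
  (h := fun z : quad => (z.1.2, z.1.1 %/ 12)%N)
  (h' := fun z : nat * nat => let: (e, i) := z in
    ((12 * i + (5 * e) %% 12, e), (12 * (N %/ e) - (12 * i + (5 * e) %% 12), e))%N));
  first exact: qbox_uniq.
move=> [[a x] [b y]] _ /andP[q /= /eqP xy]; subst y.
have [_ [a0 x0 b0 _]] := quad_minus_bound q.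
case/and5P: q => /eqP e ha /eqP hx /eqP hb _.
have [t et] : exists t, (a + b = 12 * t)%N by exists ((a + b) %/ 12)%N; lia.
have eN : N = (t * x)%N.
  have : (12 * (t * x) = 12 * N)%N by rewrite -e mulnA -et; lia.
  by lia.
have eNx : (N %/ x)%N = t by rewrite eN mulnK.
have t0 : (0 < t)%N by lia.
have le_t : (t <= N)%N by rewrite eN leq_pmulr.
have le_x : (x <= N)%N by rewrite eN leq_pmull.
have lt_a : (a %/ 12 < t)%N by lia.
split.
- by rewrite mem_nbox le_x; lia.
- by apply/and3P; split => /=; rewrite ?eNx //; [rewrite eN dvdn_mull | lia].
- rewrite eNx; have -> : (12 * (a %/ 12) + (5 * x) %% 12 = a)%N by lia.
  by congr (_, _); congr (_, _); lia.
Qed.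

Lemma twisted_sigmaE N : twisted_sigma N =
  dsum (fun e => if ((e %% 12 == 1) || (e %% 12 == 11))%N then (N %/ e)%N%:Z else 0) N -
  dsum (fun e => if ((e %% 12 == 5) || (e %% 12 == 7))%N then (N %/ e)%N%:Z else 0) N.
Proof.
rewrite /twisted_sigma /dsum -sumrB; apply: eq_bigr => e _.
have /eqP -> : chi12 e == (if ((e %% 12 == 1) || (e %% 12 == 11))%N then 1 else 0) -
    (if ((e %% 12 == 5) || (e %% 12 == 7))%N then 1 else 0).
  rewrite /chi12 -chi3_mod -chi4_mod.
  exact: (@residues12 (fun i _ => chi3 i * chi4 i ==
    (if ((i == 1) || (i == 11))%N then 1 else 0) -
      (if ((i == 5) || (i == 7))%N then 1 else 0)) e e).
by case: ifP => _; case: ifP => _; rewrite ?subr0 ?sub0r ?subrr ?mul1r ?mulN1r ?mul0r.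
Qed.

(** The off-diagonal quadruples cancel and the diagonals leave at least [twisted_sigma N]. So the
    sum in [sum_quads] is positive, and some m has both divisor sums nonzero. *)
Lemma sum_of_two_reps N : (0 < N)%N -> exists m m',
  [/\ (m + m' = 12 * N)%N, (m %% 12 = 5)%N, rep 1 m & rep 3 m'].
Proof.
move=> N0; have n0 : (12 * N %% 12 = 0)%N by lia.
have := sum_quads n0.
have split_eq (P Q : pred quad) s : count P s =
   (count (fun z => P z && ~~ Q z) s + count (fun z => P z && Q z) s)%N.
  by elim: s => //= z s ->; case: (P z); case: (Q z) => /=; lia.
rewrite (split_eq (quad_plus _) (fun z => z.1.1 == z.2.1)).
rewrite (split_eq (quad_minus _) (fun z => z.1.2 == z.2.2)).
rewrite count_plus_off count_minus_off count_omega => T.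
have := twisted_sigma_gt0 N0; rewrite twisted_sigmaE -!count_divisor_pairs // => s0.
have dp := count_plus_diag N0; have dm := count_minus_diag N0.
have : 0 < \sum_(m <- iota 0 (12 * N).+1)
   (if (m %% 12 == 5)%N && (m < 12 * N)%N then dsum uchar m * dsum uchar (12 * N - m) else 0).
  by rewrite -T; lia.
move/lt0r_neq0/eqP => {}T.
have [/hasP[m _ /andP[/andP[m5 lt_m] nz]]|/hasPn h] :=
    boolP (has (fun m => [&& (m %% 12 == 5)%N && (m < 12 * N)%N &
      dsum uchar m * dsum uchar (12 * N - m) != 0]) (iota 0 (12 * N).+1)); last first.
  exfalso; apply: T; apply: big1_seq => m /andP[_ hm]; have := h m hm.
  by case: ifP => //= _; rewrite negbK => /eqP.
move: nz; rewrite mulf_eq0 negb_or => /andP[nz1 nz2].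
exists m, (12 * N - m)%N; split; [lia|lia| |].
- apply: rep1_dsum; first lia.
    by rewrite -coprime_modl (_ : (m %% 6 = 5)%N) //; lia.
  by rewrite -dsum_uchar4 ?mulf_neq0 //; lia.
- apply: rep3_dsum; first lia.
    by rewrite -coprime_modl (_ : ((12 * N - m) %% 6 = 1)%N) //; lia.
  by rewrite -dsum_uchar3 ?mulf_neq0 //; lia.
Qed.

(** * Universality of x^2 + y^2 + z^2 + 3 w^2 *)

Definition rep1113 (n : nat) := exists x y z w : int,
  n%:Z = x * x + y * y + z * z + 3 * (w * w).

Lemma sqr_mod3 (t : int) :
  (exists i, t * t = (3 * i) * (3 * i)) \/ (exists i, t * t = (3 * i + 1) * (3 * i + 1)).
Proof.
have [i] : exists i, t = 3 * i \/ t = 3 * i + 1 \/ t = 3 * i + 2 by exists (t %/ 3)%Z; lia.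
case=> [->|[->|->]]; [by left; exists i | by right; exists i |].
by right; exists (- i - 1); ring.
Qed.

(* With A = alpha + beta, 3 B = alpha - beta for 12 N = (alpha^2 + beta^2) +
   (gamma^2 + 3 delta^2): 2 (alpha^2 + beta^2) = A^2 + 9 B^2, and
   3 (x^2 + y^2 + z^2) = (x + y + z)^2 + 2 (p^2 + p r + r^2) for p = x - y, r = y - z. *)
Lemma rep1113_8 N : (0 < N)%N -> rep1113 (8 * N).
Proof.
move=> N0; have [m [m' [e m5 [a [b em]] [c [d em']]]]] := sum_of_two_reps N0.
have {}e : 12 * N%:Z = (a * a + b * b) + (c * c + 3 * (d * d)) by rewrite mul1r in em; lia.
have [i ei] : exists i, a * a = (3 * i + 1) * (3 * i + 1).
  case: (sqr_mod3 a) (sqr_mod3 b) => [[i ei]|[i ei]]; last by exists i.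
  by move=> [[j ej]|[j ej]]; exfalso; rewrite mul1r in em; lia.
have [j ej] : exists j, b * b = (3 * j + 1) * (3 * j + 1).
  case: (sqr_mod3 b) => [[j ej]|[j ej]]; last by exists j.
  by exfalso; rewrite mul1r in em; lia.
have [k ek] : exists k, c * c = (3 * k + 2) * (3 * k + 2).
  case: (sqr_mod3 c) => [[k ek]|[k ek]]; last by exists (- k - 1); rewrite ek; ring.
  by exfalso; rewrite mul1r in em; lia.
(* With alpha = 3 i + 1, beta = 3 j + 1, gamma = 3 k + 2 and delta = d, these satisfy x + y + z = A,
   2 x - y - z = 2 gamma, y - z = 2 delta and w = B. *)
exists (i + j + 2 * k + 2), (i + j - k + d), (i + j - k - d), (i - j).
by rewrite ei ej ek in e; lia.
Qed.

(** An Eisenstein integer (u + v sqrt(-3)) / 2 with u, v odd enters Z[sqrt(-3)] after multiplication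
    by a suitable cube root of unity, with the same norm. *)
Lemma odd_sqr3 z w : exists c d : int,
  (2 * z + 1) * (2 * z + 1) + 3 * ((2 * w + 1) * (2 * w + 1)) = 4 * (c * c + 3 * (d * d)).
Proof.
have [e] : exists e, z = w + 2 * e \/ z = 2 * e - 1 - w.
  have [e] : exists e : int, z - w = 2 * e \/ z - w = 2 * e + 1 by exists ((z - w) %/ 2)%Z; lia.
  by case=> h; [exists e; left; lia | exists (e + w + 1); right; lia].
case=> ->; first by exists (2 * w + 1 + e), e; ring.
by exists (- (2 * w + 1) + e), e; ring.
Qed.

Lemma rep1113_quarter n : rep1113 (4 * n) -> rep1113 n.
Proof.
have par (t : int) : exists s b : int, t = 2 * s + b /\ (b = 0 \/ b = 1).
  by exists (t %/ 2)%Z, (t %% 2)%Z; lia.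
move=> [x [y [z [w]]]]; rewrite PoszM.
have [x1 [a [-> ha]]] := par x; have [y1 [b [-> hb]]] := par y.
have [z1 [c [-> hc]]] := par z; have [w1 [d [-> hd]]] := par w.
(* Mod 4, either all four are even, or w and exactly one of x, y, z are odd; [odd_sqr3] then
   replaces that pair and the others are halved. *)
case: ha => ->; case: hb => ->; case: hc => ->; case: hd => -> e; try by exfalso; lia.
- by exists x1, y1, z1, w1; lia.
- by have [u [v euv]] := odd_sqr3 z1 w1; exists x1, y1, u, v; lia.
- by have [u [v euv]] := odd_sqr3 y1 w1; exists x1, z1, u, v; lia.
- by have [u [v euv]] := odd_sqr3 x1 w1; exists y1, z1, u, v; lia.
Qed.

(** [rep1113_8] reaches multiples of 8, in particular 16 n, from which the descent is made twice. *)
Lemma rep1113_universal n : (0 < n)%N -> rep1113 n.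
Proof.
move=> n0; apply/rep1113_quarter/rep1113_quarter.
have -> : (4 * (4 * n) = 8 * (2 * n))%N by lia.
by apply: rep1113_8; lia.
Qed.

(** [zexp 1 5 a] is 3 a^2 - 2 a, and three times it plus 1 is (3 a - 1)^2. In 3 n + 1 = x^2 + y^2 +
    z^2 + 3 w^2 exactly one of x, y, z is prime to 3 and yields a; w is b, and the other two are 3 c
    and 3 d. *)
Lemma theta_universal n : exists a b c d : int,
  n = (zexp 1 5 a + zexp 1 1 b + 3 * zexp 1 1 c + 3 * zexp 1 1 d)%N.
Proof.
suff [a [b [c [d e]]]] : exists a b c d : int,
    n%:Z = 3 * (a * a) - 2 * a + b * b + 3 * (c * c) + 3 * (d * d).
  exists a, b, c, d; have := zexpE 1 5 a; have := zexpE 1 1 b.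
  by have := zexpE 1 1 c; have := zexpE 1 1 d; lia.
have n0 : (0 < 3 * n + 1)%N by lia.
have [x [y [z [w]]]] := rep1113_universal n0; rewrite PoszD PoszM.
case: (sqr_mod3 x) => [[i ->]|[i ->]]; case: (sqr_mod3 y) => [[j ->]|[j ->]];
  case: (sqr_mod3 z) => [[k ->]|[k ->]] e; try by exfalso; lia.
- by exists (- k), w, i, j; lia.
- by exists (- j), w, i, k; lia.
- by exists (- i), w, j, k; lia.
Qed.

(** * The eight eta quotients *)

Definition strict (a : fps int) := forall n, 0 < a n.

Lemma strictM a b : strict a -> nonneg b -> 0 < b 0%N -> strict (a * b).
Proof.
by move=> a0 b0 b1 n; apply: (mul_pos (i := n) (j := 0)); rewrite ?addn0 // => i; apply: ltW.
Qed.

Lemma strict_residues m (a b : fps int) : (0 < m)%N -> nonneg a -> nonneg b ->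
  (forall r, (r < m)%N -> 0 < a r) -> (forall k, 0 < b (m * k)%N) -> strict (a * b).
Proof.
move=> m0 a0 b0 ar bk n; apply: (mul_pos (i := n %% m) (j := m * (n %/ m))) => //.
  by apply: ar; rewrite ltn_mod.
by rewrite mulnC addnC -divn_eq.
Qed.

Definition phi : fps int := theta 1 1 1.
Definition f15 : fps int := theta 1 1 5.

Lemma phi_nonneg : nonneg phi. Proof. exact: theta1_nonneg. Qed.
Lemma f15_nonneg : nonneg f15. Proof. exact: theta1_nonneg. Qed.
Lemma phi3_nonneg : nonneg (dilate 3 phi).
Proof. exact/nonneg_dilate/phi_nonneg. Qed.

Lemma phi_pos x : 0 < phi (zexp 1 1 x). Proof. exact: theta1_pos. Qed.
Lemma phi3_pos x : 0 < dilate 3 phi (3 * zexp 1 1 x)%N.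
Proof. by rewrite dilate_nmul // phi_pos. Qed.
Lemma f15_pos x : 0 < f15 (zexp 1 5 x). Proof. exact: theta1_pos. Qed.

Lemma twist_phi : twist (f 1 ^+ 2 * g 2) = phi.
Proof. by rewrite -theta_phi twist_theta. Qed.

Lemma phi0 : phi 0%N = 1.
Proof. by rewrite -twist_phi /twist mul1r expr2 !fpsM !big_ord1 /= fpsM big_ord1 !f0 g0. Qed.

Lemma twist_phi3 : twist (f 3 ^+ 2 * g 6) = dilate 3 phi.
Proof.
by rewrite -twist_phi -twist_dilate_odd // [dilate 3 _]rmorphM rmorphXn /= dilate_f // dilate_g.
Qed.

Lemma twist_f15 : twist (f 1 * f 6 ^+ 2 * g 2 * g 3) = f15.
Proof. by rewrite -theta_15 twist_theta. Qed.

Lemma twist_dodd3 : twist (f 3 * g 6) = dilate 3 dodd.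
Proof. by rewrite /dodd -twist_dilate_odd // [dilate 3 _]rmorphM /= dilate_f // dilate_g. Qed.

Lemma core3_nonneg : nonneg core3.
Proof. by move=> n; rewrite (core3_count (leqnn _)). Qed.

Lemma core3_pos n : (n < 3)%N -> 0 < core3 n.
Proof.
move=> n3; rewrite (core3_count (leqnn _)) ltz_nat -has_count; apply/hasP.
by case: n n3 => [|[|[|]]] // _; [exists (0, 0) | exists (0, -1) | exists (-1, 0)];
  rewrite // mem_zbox.
Qed.

Lemma phi_f15_pos r : (r < 3)%N -> 0 < (phi * f15) r.
Proof.
case: r => [|[|[|]]] // _.
- exact: (mul_pos phi_nonneg f15_nonneg (phi_pos 0) (f15_pos 0)).
- exact: (mul_pos phi_nonneg f15_nonneg (phi_pos 1) (f15_pos 0)).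
- exact: (mul_pos phi_nonneg f15_nonneg (phi_pos 1) (f15_pos 1)).
Qed.

Lemma phi_f15_nonneg : nonneg (phi * f15).
Proof. exact: nonnegM phi_nonneg f15_nonneg. Qed.

Lemma strict_phi_dodd : strict (phi * dodd).
Proof.
(* As d_2 = 0, the exponent 2 is reached as 1 + 1. *)
move=> n; case: (eqVneq n 2%N) => [->|n2].
  by apply: (mul_pos (i := 1) (j := 1) phi_nonneg dodd_nonneg (phi_pos 1)); rewrite ?dodd1.
apply: (mul_pos (i := 0) (j := n) phi_nonneg dodd_nonneg (phi_pos 0)) => //.
exact: lt_le_trans (dodd_ge1 n2).
Qed.

Lemma strict_core3 : strict (core3 * g 3).
Proof.
apply: (strict_residues (m := 3)) => //.
- exact: core3_nonneg.
- exact: g_nonneg.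
- exact: core3_pos.
- by move=> k; apply: g_pos.
Qed.

Lemma strict_core3_phi : strict (phi * dilate 2 (core3 * g 3) * dilate 3 phi ^+ 2).
Proof.
apply: strictM; last by rewrite exp_pos0 // /dilate phi0.
  apply: (strict_residues (m := 2)) => //.
  - exact: phi_nonneg.
  - by apply: nonneg_dilate => n; apply/ltW/strict_core3.
  - by case=> [|[|]] // _; [exact: (phi_pos 0) | exact: (phi_pos 1)].
  - by move=> k; rewrite dilate_nmul // strict_core3.
exact: nonnegX phi3_nonneg.
Qed.

Lemma strict_f15_4 : strict (f15 ^+ 4 * g 6 ^+ 8).
Proof.
have fo2 : nonneg (f15 * f15) by apply: nonnegM; apply: f15_nonneg.
have fo2_pos r : (r < 3)%N -> 0 < (f15 * f15) r.
  case: r => [|[|[|]]] // _.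
  - exact: (mul_pos f15_nonneg f15_nonneg (f15_pos 0) (f15_pos 0)).
  - exact: (mul_pos f15_nonneg f15_nonneg (f15_pos 1) (f15_pos 0)).
  - exact: (mul_pos f15_nonneg f15_nonneg (f15_pos 1) (f15_pos 1)).
have -> : f15 ^+ 4 * g 6 ^+ 8 = (f15 * f15) * (f15 * f15) * g 6 * g 6 ^+ 7 by ring.
have g6 : nonneg (g 6) by apply: g_nonneg.
apply: strictM; [|exact: nonnegX|by rewrite exp_pos0 ?g0].
apply: (strict_residues (m := 6)) => //; [exact: nonnegM| |by move=> k; apply: g_pos].
case=> [|[|[|[|[|[|]]]]]] // _.
- exact: (mul_pos (i := 0) (j := 0) fo2 fo2 (fo2_pos _ _) (fo2_pos _ _)).
- exact: (mul_pos (i := 0) (j := 1) fo2 fo2 (fo2_pos _ _) (fo2_pos _ _)).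
- exact: (mul_pos (i := 1) (j := 1) fo2 fo2 (fo2_pos _ _) (fo2_pos _ _)).
- exact: (mul_pos (i := 1) (j := 2) fo2 fo2 (fo2_pos _ _) (fo2_pos _ _)).
- exact: (mul_pos (i := 2) (j := 2) fo2 fo2 (fo2_pos _ _) (fo2_pos _ _)).
(* Four exponents 0 or 1 reach only 4; the residue 5 uses 3 a^2 - 2 a = 5 at a = -1. *)
- apply: (mul_pos (i := 0) (j := 5) fo2 fo2 (fo2_pos _ _)) => //.
  exact: (mul_pos f15_nonneg f15_nonneg (f15_pos (-1)) (f15_pos 0)).
Qed.

Lemma strict_phi_f15_g6 : strict (phi * f15 * dilate 3 phi * g 6).
Proof.
have n3 := nonnegM phi_f15_nonneg phi3_nonneg.
apply: (strict_residues (m := 6)) => //; [exact: g_nonneg| |by move=> k; apply: g_pos].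
move=> r r6; have [r3|r3] := ltnP r 3.
  apply: (mul_pos (i := r) (j := 0) phi_f15_nonneg phi3_nonneg (phi_f15_pos r3) (phi3_pos 0)).
  by rewrite addn0.
apply: (mul_pos (i := r - 3) (j := 3) phi_f15_nonneg phi3_nonneg _ (phi3_pos 1)).
  by apply: phi_f15_pos; lia.
by lia.
Qed.

Lemma strict_phi_f15_dodd : strict (phi * f15 * dilate 3 (phi * dodd)).
Proof.
apply: (strict_residues (m := 3)) => //.
- exact: phi_f15_nonneg.
- by apply: nonneg_dilate => n; apply/ltW/strict_phi_dodd.
- exact: phi_f15_pos.
- by move=> k; rewrite dilate_nmul // strict_phi_dodd.
Qed.

Lemma strict_phi_f15_phi3 : strict (f15 * phi * dilate 3 phi * dilate 3 phi).
Proof.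
move=> n; have [a [b [c [d en]]]] := theta_universal n.
have n1 := nonnegM f15_nonneg phi_nonneg; have n2 := nonnegM n1 phi3_nonneg.
apply: (mul_pos n2 phi3_nonneg _ (phi3_pos d)); last exact: en.
apply: (mul_pos n1 phi3_nonneg _ (phi3_pos c)); last by [].
exact: (mul_pos f15_nonneg phi_nonneg (f15_pos a) (phi_pos b)).
Qed.

(** * Factorizations of the eight quotients *)

Lemma fps_expz_nat j k : fps_expz (f j) (Posz k) = f j ^+ k.
Proof. by elim: k => // k IHk; rewrite exprS -IHk. Qed.

Lemma fps_expz_neg j k : fps_expz (f j) (Negz k) = g j ^+ k.+1.
Proof. by elim: k => [|k IHk]; rewrite exprS /= ?expr0 // -IHk. Qed.

Lemma eta_quotient3 t1 t2 t3 : eta_quotient [tuple t1; t2; t3] =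
  fps_expz (f 1) t1 * (fps_expz (f 2) t2 * fps_expz (f 3) t3).
Proof.
rewrite -[fps_expz (f 3) t3]mulr1.
by rewrite /eta_quotient !big_ord_recl big_ord0 !(tnth_nth 0).
Qed.

(** The exponents say how many cancelled pairs f_j g_j = 1 to restore, after which the identity is
    polynomial and [ring] decides it. *)
Lemma cancel_fg (a b : fps int) i j k : a = b * (f 2 * g 2) ^+ i * (f 3 * g 3) ^+ j * (f 6 * g 6) ^+ k ->
  a = b.
Proof. by rewrite !fgK !expr1n !mulr1. Qed.

Theorem theorem2p1 (t1 t2 t3 : int) (ht : (t1, t2, t3) \in S1) (n : nat) :
  0 < eta_quotient [tuple t1; t2; t3] (2 * n)%N /\
  eta_quotient [tuple t1; t2; t3] (2 * n + 1)%N < 0.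
Proof.
suff pos : strict (twist (eta_quotient [tuple t1; t2; t3])).
  have := pos (2 * n)%N; have := pos (2 * n + 1)%N.
  rewrite /twist exprD exprM sqrrN !expr1n !mul1r mulN1r oppr_gt0; by split.
have tg6 : twist (g 6) = g 6 by apply: twist_even_g.
have tc : twist (dilate 2 (core3 * g 3)) = dilate 2 (core3 * g 3) by apply: twist_dilate_even.
have ec : dilate 2 (core3 * g 3) = f 6 ^+ 3 * g 2 * g 6.
  by rewrite /core3 !(rmorphXn, rmorphM) /= dilate_f // !dilate_g.
rewrite eta_quotient3; move: ht; rewrite /S1 !inE.
do ?[case/orP]; move=> /eqP[-> -> ->].
- have -> : fps_expz (f 1) 2 * (fps_expz (f 2) (-3) * fps_expz (f 3) (-3)) =
     (f 1 * g 2) * psi_quot * g 6 ^+ 6.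
    rewrite fps_expz_nat !fps_expz_neg /psi_quot; apply/esym.
    by apply: (@cancel_fg _ _ 0 0 6); ring.
  rewrite rmorphM rmorphXn [X in X * _]rmorphM /= tg6 -/dodd.
  apply: strictM; [exact: dodd_twist_psi_quot_pos|by apply/nonnegX/g_nonneg|by rewrite exp_pos0 ?g0].
- have -> : fps_expz (f 1) 2 * (fps_expz (f 2) (-2) * fps_expz (f 3) 4) =
     (f 1 ^+ 2 * g 2) * dilate 2 (core3 * g 3) * (f 3 ^+ 2 * g 6) ^+ 2.
    rewrite !fps_expz_nat !fps_expz_neg ec; apply/esym.
    by apply: (@cancel_fg _ _ 0 0 3); ring.
  rewrite rmorphM rmorphXn [X in X * _]rmorphM /= tc twist_phi twist_phi3.
  exact: strict_core3_phi.
- have -> : fps_expz (f 1) 3 * (fps_expz (f 2) (-2) * fps_expz (f 3) 0) =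
     (f 1 ^+ 2 * g 2) * (f 1 * g 2).
    by rewrite !fps_expz_nat !fps_expz_neg; ring.
  rewrite rmorphM /= twist_phi -/dodd; exact: strict_phi_dodd.
- have -> : fps_expz (f 1) 3 * (fps_expz (f 2) (-2) * fps_expz (f 3) 1) =
     (f 1 ^+ 2 * g 2) * (f 1 * f 6 ^+ 2 * g 2 * g 3) * (f 3 ^+ 2 * g 6) * g 6.
    rewrite !fps_expz_nat !fps_expz_neg; apply/esym.
    by apply: (@cancel_fg _ _ 0 1 2); ring.
  rewrite rmorphM [X in X * _]rmorphM [X in X * _ * _]rmorphM /= twist_phi twist_f15 twist_phi3 tg6.
  exact: strict_phi_f15_g6.
- have -> : fps_expz (f 1) 3 * (fps_expz (f 2) (-2) * fps_expz (f 3) 2) =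
     (f 1 ^+ 2 * g 2) * (f 1 * f 6 ^+ 2 * g 2 * g 3) * ((f 3 ^+ 2 * g 6) * (f 3 * g 6)).
    rewrite !fps_expz_nat !fps_expz_neg; apply/esym.
    by apply: (@cancel_fg _ _ 0 1 2); ring.
  rewrite rmorphM [X in X * _]rmorphM [X in _ * X]rmorphM /= twist_phi twist_f15 twist_phi3 twist_dodd3.
  rewrite -rmorphM; exact: strict_phi_f15_dodd.
- have -> : fps_expz (f 1) 3 * (fps_expz (f 2) (-2) * fps_expz (f 3) 3) =
     (f 1 * f 6 ^+ 2 * g 2 * g 3) * (f 1 ^+ 2 * g 2) * (f 3 ^+ 2 * g 6) * (f 3 ^+ 2 * g 6).
    rewrite !fps_expz_nat !fps_expz_neg; apply/esym.
    by apply: (@cancel_fg _ _ 0 1 2); ring.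
  rewrite rmorphM [X in X * _]rmorphM [X in X * _ * _]rmorphM /= twist_phi twist_f15 twist_phi3.
  exact: strict_phi_f15_phi3.
- have -> : fps_expz (f 1) 4 * (fps_expz (f 2) (-4) * fps_expz (f 3) (-4)) =
     (f 1 * f 6 ^+ 2 * g 2 * g 3) ^+ 4 * g 6 ^+ 8.
    rewrite !fps_expz_nat !fps_expz_neg; apply/esym.
    by apply: (@cancel_fg _ _ 0 0 8); ring.
  rewrite rmorphM !rmorphXn /= twist_f15 tg6; exact: strict_f15_4.
- have -> : fps_expz (f 1) 4 * (fps_expz (f 2) (-3) * fps_expz (f 3) 4) =
     (f 1 ^+ 2 * g 2) * dilate 2 (core3 * g 3) * (f 3 ^+ 2 * g 6) ^+ 2 * (f 1 ^+ 2 * g 2).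
    rewrite !fps_expz_nat !fps_expz_neg ec; apply/esym.
    by apply: (@cancel_fg _ _ 0 0 3); ring.
  rewrite rmorphM [X in X * _]rmorphM rmorphXn [X in X * _ * _]rmorphM /= tc twist_phi twist_phi3.
  apply: strictM; [exact: strict_core3_phi | exact: phi_nonneg | exact: (phi_pos 0)].
Qed.
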